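(* Let $d>1/\cos(\pi/7)$ and consider the $P_1$ (continuous piecewise linear) finite-element discretization on the triangular mesh of the regular heptagon described in the context. If every internal angle of every triangle in the mesh does not exceed $\pi/2$, then this discretization satisfies the unique continuation principle, i.e. $\mathcal{S}_{\rm in}(\lambda)=\{0\}$ for all $\lambda\in\mathbb{R}$.
   Context: The mesh has a node at $(0,0)$; an inner ring of nodes at $(\cos\frac{2j\pi}{7},\sin\frac{2j\pi}{7})$, $0\le j\le6$; and an outer ring of nodes at $(d\cos\frac{(2j+1)\pi}{7},d\sin\frac{(2j+1)\pi}{7})$, $0\le j\le6$. The domain $\Omega$ is the regular heptagon whose corners are the outer-ring nodes, and it is divided into 21 triangles: seven with vertices the origin and two consecutive inner-ring nodes; seven with vertices two consecutive inner-ring nodes and the outer-ring node lying between them in angle; and seven with vertices two consecutive outer-ring nodes and the inner-ring node lying between them in angle. The boundary nodes are the seven outer-ring nodes; the remaining eight nodes are interior. For each node $\boldsymbol{x}_i$, $\phi_i$ is the continuous function on $\overline\Omega$ that is affine on each triangle with $\phi_i(\boldsymbol{x}_j)=\delta_{i,j}$; the stiffness and mass matrices are $a_{i,j}=\int_\Omega\nabla\phi_j\cdot\nabla\phi_i\,dA$ and $m_{i,j}=\int_\Omega\phi_j\phi_i\,dA$. With respect to the partition into interior nodes ($I$) and boundary nodes ($B$), write $$A=\begin{pmatrix} A_{II} & A_{IB} \\ A_{BI} & A_{BB} \end{pmatrix},\qquad M=\begin{pmatrix} M_{II} & M_{IB} \\ M_{BI} & M_{BB} \end{pmatrix},$$ and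 define $\mathcal{S}_{\rm in}(\lambda)=\ker(A_{II}-\lambda M_{II})\cap\ker(A_{BI}-\lambda M_{BI})$. *)

(* Defs.v *)
From HB Require Import structures.
From mathcomp Require Import all_boot all_order all_algebra.
From mathcomp Require Import all_classical all_reals all_analysis.

Set Implicit Arguments.
Unset Strict Implicit.
Unset Printing Implicit Defensive.

Import Order.TTheory GRing.Theory Num.Theory.
Import numFieldNormedType.Exports.

Local Open Scope classical_set_scope.
Local Open Scope ring_scope.

Section PlaneGeometry.
Context {R : realType}.

Definition dot (u v : R * R) : R := u.1 * v.1 + u.2 * v.2.

(* The library norm on [R * R] is the max norm. *)
Definition euclidean_norm (v : R * R) : R := Num.sqrt (dot v v).

Definition hull (n : nat) (P : 'I_n -> R * R) : set (R * R) :=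
  [set p | exists w : 'I_n -> R,
     [/\ forall i, 0 <= w i, \sum_i w i = 1 & p = \sum_i w i *: P i]].

Definition internal_angle (P : 'I_3 -> R * R) (k : 'I_3) : R :=
  let u := P (ordS k) - P k in
  let v := P (ordS (ordS k)) - P k in
  acos (dot u v / (euclidean_norm u * euclidean_norm v)).

Definition affine_on (D : set (R * R)) (f : R * R -> R) : Prop :=
  exists a b c : R, forall p, D p -> f p = a + b * p.1 + c * p.2.

Definition grad (f : R * R -> R) (p : R * R) : R * R :=
  ('D_(1, 0) f p, 'D_(0, 1) f p).

Definition area_integral (D : set (R * R)) (f : R * R -> R) : R :=
  \int[(@lebesgue_measure R \x @lebesgue_measure R)%E]_(p in D) f p.

End PlaneGeometry.

Section Mesh.
Context {R : realType} (d : R).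

(* The origin comes first, then the inner ring, then the outer ring: the first
   1 + 7 nodes are the interior ones and the last 7 the boundary ones, so that
   the block decomposition of matrices over ['I_(1 + 7 + 7)] is the I/B one. *)
Definition node_index := 'I_(1 + 7 + 7).

Definition origin_node : node_index := lshift 7 (lshift 7 ord0).
Definition inner_node (j : 'I_7) : node_index := lshift 7 (rshift 1 j).
Definition outer_node (j : 'I_7) : node_index := rshift (1 + 7) j.

Definition inner_point (j : 'I_7) : R * R :=
  (cos (2 * j%:R * pi / 7), sin (2 * j%:R * pi / 7)).

Definition outer_point (j : 'I_7) : R * R :=
  (d * cos ((2 * j%:R + 1) * pi / 7), d * sin ((2 * j%:R + 1) * pi / 7)).

Definition node (i : node_index) : R * R :=
  match fintype.split i with
  | inl k => match fintype.split k with
             | inl _ => (0, 0)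
             | inr j => inner_point j
             end
  | inr j => outer_point j
  end.

(* In angle, [outer_node j] lies between [inner_node j] and
   [inner_node (ordS j)], and [inner_node (ordS j)] lies between [outer_node j]
   and [outer_node (ordS j)]; [ordS] is the cyclic successor on ['I_7]. *)
Definition triangles : seq (3.-tuple node_index) :=
  [seq [tuple origin_node; inner_node j; inner_node (ordS j)]
     | j <- enum 'I_7] ++
  [seq [tuple inner_node j; inner_node (ordS j); outer_node j]
     | j <- enum 'I_7] ++
  [seq [tuple outer_node j; outer_node (ordS j); inner_node (ordS j)]
     | j <- enum 'I_7].

Definition vertices (t : 3.-tuple node_index) (k : 'I_3) : R * R :=
  node (tnth t k).

Definition heptagon : set (R * R) := hull outer_point.

Definition Omega : set (R * R) := interior heptagon.

(* [phi] is the nodal basis. These conditions determine [phi i] on the closed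
   heptagon; its values elsewhere are irrelevant, since only integrals over the
   open set [Omega] are taken. *)
Definition nodal_basis (phi : node_index -> R * R -> R) : Prop :=
  forall i : node_index,
    [/\ {within heptagon, continuous (phi i)},
        forall t, t \in triangles -> affine_on (hull (vertices t)) (phi i) &
        forall j : node_index, phi i (node j) = (i == j)%:R].

(* The gradients are defined off the edges of the mesh, a set of area zero. *)
Definition stiffness (phi : node_index -> R * R -> R) : 'M[R]_(1 + 7 + 7) :=
  \matrix_(i, j)
    area_integral Omega (fun p => dot (grad (phi j) p) (grad (phi i) p)).

Definition mass (phi : node_index -> R * R -> R) : 'M[R]_(1 + 7 + 7) :=
  \matrix_(i, j) area_integral Omega (fun p => phi j p * phi i p).

Definition S_in (phi : node_index -> R * R -> R) (lambda : R) :
    set 'cV[R]_(1 + 7) :=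
  let A := stiffness phi in
  let M := mass phi in
  [set u | (ulsubmx A - lambda *: ulsubmx M) *m u = 0] `&`
  [set u | (dlsubmx A - lambda *: dlsubmx M) *m u = 0].

End Mesh.

(* Main.v *)
(** The open triangles cover the heptagon up to finitely many lines, so every
    integral over Omega is an integral over their union, where the gradients
    are piecewise constant.  Nonobtuse angles make the off-diagonal entries of
    the stiffness matrix nonpositive, and neighbouring nodes have positive mass
    entries.  If lambda <= 0, the quadratic form of A_II - lambda M_II is at
    least the Dirichlet energy, and a finite element function without energy
    that vanishes on the boundary is zero.  If lambda > 0, the off-diagonal
    entries of A - lambda M between neighbours are negative; the row of an outer
    node involves just two consecutive inner nodes, so the inner values
    alternate in sign around a cycle of odd length 7 and vanish, and then the
    row of an inner node forces the value at the origin to vanish. *)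

Require Import Defs.
From HB Require Import structures.
From mathcomp Require Import all_boot all_order all_algebra.
From mathcomp Require Import all_classical all_reals all_analysis.
From mathcomp Require Import measurable_realfun.
From mathcomp Require Import ring lra zify.

Import Order.TTheory GRing.Theory Num.Theory.
Import numFieldNormedType.Exports.

Local Open Scope classical_set_scope.
Local Open Scope ring_scope.

(** * Integrals and null sets *)

Section IntegralAlmostEverywhere.
Context {disp : measure_display} {T : measurableType disp} {R : realType}.
Variable mu : {measure set T -> \bar R}.
Local Open Scope ereal_scope.
Import HBNNSimple.

(* A simple function keeps its integral when it is set to zero on a null set,
   so no measurability of [f] and [g] is needed. *)
Let le_sup_sintegral (f g : T -> \bar R) (N : set T) :
  measurable N -> mu N = 0 -> (forall x, 0 <= g x) ->
  (forall x, ~ N x -> f x = g x) ->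
  ereal_sup [set sintegral mu h |
    h in [set h : {nnsfun T >-> R} | forall x, (h x)%:E <= f x]] <=
  ereal_sup [set sintegral mu h |
    h in [set h : {nnsfun T >-> R} | forall x, (h x)%:E <= g x]].
Proof.
move=> mN N0 g0 fg; apply: ge_ereal_sup => _ [h /= hf <-].
have mCN : measurable (~` N) by exact: measurableC.
apply: ereal_sup_ubound => /=; exists (proj_nnsfun h mCN) => /=.
  move=> x; rewrite mindicE; have [xN|xN] := boolP (x \in ~` N).
    by rewrite mulr1 -fg//; rewrite inE in xN.
  by rewrite mulr0.
rewrite -!integralT_nnsfun; apply: ae_eq_integral => //;
  [exact/measurable_EFinP/measurable_funP|exact/measurable_EFinP/measurable_funP|].
exists N; split => // x /= /not_implyP[_] hx.
apply: contrapT => Nx; apply: hx; congr (_%:E).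
by rewrite mindicE mem_set ?mulr1.
Qed.

(** The restrictions of [f] to [D] and [E] agree off [N], hence so do their positive and negative
    parts, whose integrals are suprema over simple functions. This passes from Omega to the union of
    the open triangles. *)
Lemma integral_eq_off_null (D E N : set T) (f : T -> \bar R) :
  measurable N -> mu N = 0 -> E `<=` D -> D `<=` E `|` N ->
  \int[mu]_(x in D) f x = \int[mu]_(x in E) f x.
Proof.
move=> mN N0 ED DE.
have fDE x : ~ N x -> (f \_ D) x = (f \_ E) x.
  move=> Nx; rewrite !patchE.
  have [xE|xE] := boolP (x \in E).
    by rewrite mem_set//; apply: ED; rewrite inE in xE.
  by rewrite memNset// => /DE[Ex|//]; rewrite mem_set in xE.
rewrite /integral; congr (_ - _); apply/eqP; rewrite eq_le; apply/andP; split;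
  apply: (le_sup_sintegral _ _ N) => // x /fDE fx.
all: by rewrite ?funeposE ?funenegE fx.
Qed.

End IntegralAlmostEverywhere.

(** * Finite unions indexed by the members of a list *)

Definition seq_union {T : Type} {I : eqType} (F : I -> set T) (r : seq I) : set T :=
  [set x | exists2 i, i \in r & F i x].

Section FiniteUnion.
Context {disp : measure_display} {T : measurableType disp} {R : realType}.
Variables (mu : {measure set T -> \bar R}) (I : eqType) (F : I -> set T).
Implicit Type r : seq I.

Let seq_union_nil : seq_union F [::] = set0.
Proof. by apply/seteqP; split => x // -[i]. Qed.

Let seq_union_cons i r : seq_union F (i :: r) = F i `|` seq_union F r.
Proof.
apply/seteqP; split => x /=.
  by move=> [j]; rewrite inE => /predU1P[->|jr] Fj; [left|right; exists j].
move=> [Fi|[j jr Fj]]; first by exists i; rewrite ?mem_head.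
by exists j => //; rewrite inE jr orbT.
Qed.

Lemma measurable_seq_union r :
  (forall i, i \in r -> measurable (F i)) -> measurable (seq_union F r).
Proof.
elim: r => [|i r IH] mF; first by rewrite seq_union_nil.
rewrite seq_union_cons; apply: measurableU; first by apply: mF; rewrite mem_head.
by apply: IH => j jr; apply: mF; rewrite inE jr orbT.
Qed.

Lemma measure_seq_union_eq0 r : (forall i, i \in r -> measurable (F i)) ->
  (forall i, i \in r -> mu (F i) = 0%E) -> mu (seq_union F r) = 0%E.
Proof.
elim: r => [|i r IH] mF muF; first by rewrite seq_union_nil measure0.
have jr j : j \in r -> j \in i :: r by rewrite inE orbC => ->.
rewrite seq_union_cons; apply: null_set_setU.
- by apply: mF; rewrite mem_head.
- by apply: measurable_seq_union => j /jr; exact: mF.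
- by apply: muF; rewrite mem_head.
- by apply: IH => j /jr; [exact: mF|exact: muF].
Qed.

Lemma measurable_fun_seq_union d' (T' : measurableType d') r (f : T -> T') :
  (forall i, i \in r -> measurable (F i)) ->
  (forall i, i \in r -> measurable_fun (F i) f) ->
  measurable_fun (seq_union F r) f.
Proof.
elim: r => [|i r IH] mF mf.
  by rewrite seq_union_nil; exact: measurable_fun_set0.
have jr j : j \in r -> j \in i :: r by rewrite inE orbC => ->.
rewrite seq_union_cons; apply/measurable_funU.
- by apply: mF; rewrite mem_head.
- by apply: measurable_seq_union => j /jr; exact: mF.
split; first by apply: mf; rewrite mem_head.
by apply: IH => j /jr; [exact: mF|exact: mf].
Qed.

End FiniteUnion.

(** * Area measure: affine functions, lines and boxes *)

Section PlaneMeasure.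
Context {R : realType}.

Definition plane_measure :
    {measure set (measurableTypeR R * measurableTypeR R) -> \bar R} :=
  (@lebesgue_measure R \x @lebesgue_measure R)%E.

Lemma plane_measureX (A B : set (measurableTypeR R)) :
  measurable A -> measurable B ->
  plane_measure (A `*` B) = (lebesgue_measure A * lebesgue_measure B)%E.
Proof. exact: product_measure1E. Qed.

Lemma measurable_affine (D : set (R * R)) (a b c : R) :
  measurable_fun (D : set (measurableTypeR R * measurableTypeR R))
    (fun p : measurableTypeR R * measurableTypeR R => a + b * p.1 + c * p.2 : R).
Proof.
apply: (@measurable_funTS _ _ _ _ D).
have m1 : measurable_fun setT (fun p : measurableTypeR R * measurableTypeR R => p.1 : R).
  exact: measurable_fst.
have m2 : measurable_fun setT (fun p : measurableTypeR R * measurableTypeR R => p.2 : R).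
  exact: measurable_snd.
by apply: measurable_funD; [apply: measurable_funD => //|];
  apply: measurable_funM.
Qed.

Lemma measurable_line (a b c : R) :
  measurable ([set p | a * p.1 + b * p.2 = c] :
    set (measurableTypeR R * measurableTypeR R)).
Proof.
have := measurable_affine setT 0 a b.
move=> /(_ measurableT [set c] (measurable_set1 c)).
rewrite setTI; congr (measurable _); apply/seteqP.
by split => p /=; rewrite add0r.
Qed.

(** A vertical line is the product of a point with the real line, and 0 times infinity is 0 here.
    Any other line meets each vertical line in one point, so the inner integral vanishes. *)
Lemma plane_measure_line (a b c : R) : (a != 0) || (b != 0) ->
  plane_measure [set p | a * p.1 + b * p.2 = c] = 0%E.
Proof.
have [->|b0 _] := eqVneq b 0.
  rewrite orbF => a0.
  rewrite (_ : [set p | _] = [set c / a] `*` setT).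
    rewrite plane_measureX//.
    rewrite [X in (X * _)%E](_ : _ = 0%E) ?mul0e//.
    exact: lebesgue_measure_set1.
  apply/seteqP; split => -[x y] /=; rewrite mul0r addr0.
    by move=> <-; split => //; rewrite mulrAC divff ?mul1r.
  by move=> [-> _]; rewrite mulrC divfK.
rewrite /plane_measure /= /product_measure1; apply: integral0_eq => x _ /=.
rewrite (_ : xsection _ _ = [set (c - a * x) / b]) ?lebesgue_measure_set1//.
apply/seteqP; split => y; rewrite /xsection /= inE /=.
  by move=> <-; rewrite addrAC subrr add0r mulrAC divff ?mul1r.
by move=> ->; rewrite mulrCA divff// mulr1 addrC subrK.
Qed.

Lemma plane_measure_box (a b c e : R) :
  plane_measure ([set` `]a, b[] `*` [set` `]c, e[]) =
    ((if a < b then b - a else 0) * (if c < e then e - c else 0))%:E.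
Proof.
rewrite plane_measureX//= !lebesgue_measure_itv/= !lte_fin.
by do 2 case: ifP => _; rewrite ?mul0e ?mule0 ?mul0r ?mulr0// -!EFinB -EFinM.
Qed.

(** Balls of the max norm are squares, and the area of a square is explicit. *)
Lemma nbhs_plane_measure_gt0 (A : set (R * R)) (p : R * R) :
  measurable (A : set (measurableTypeR R * measurableTypeR R)) ->
  nbhs p A -> (0 < plane_measure A)%E.
Proof.
move=> mA; rewrite -nbhs_ballE => -[e /= e0 pA].
pose box : set (R * R) := [set` `]p.1 - e, p.1 + e[] `*` [set` `]p.2 - e, p.2 + e[].
have mbox : measurable (box : set (measurableTypeR R * measurableTypeR R)).
  by apply: measurableX.
apply: (@lt_le_trans _ _ (plane_measure box)); last first.
  apply: le_measure; rewrite ?inE// => -[x y] [] /=.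
  rewrite !in_itv/= => /andP[x1 x2] /andP[y1 y2]; apply: pA; split => /=;
  by rewrite /ball/= ltr_norml; apply/andP; split; lra.
rewrite /box plane_measure_box lte_fin.
by rewrite !ifT; [nra|lra|lra].
Qed.

Lemma bounded_plane_measure (A : set (R * R)) (M : R) :
  measurable (A : set (measurableTypeR R * measurableTypeR R)) ->
  (forall p, A p -> `|p.1| < M /\ `|p.2| < M) -> (plane_measure A < +oo)%E.
Proof.
move=> mA AM.
pose box : set (R * R) := [set` `]- M, M[] `*` [set` `]- M, M[].
have mbox : measurable (box : set (measurableTypeR R * measurableTypeR R)).
  by apply: measurableX.
apply: (@le_lt_trans _ _ (plane_measure box)); last first.
  by rewrite /box plane_measure_box ltry.
apply: le_measure; rewrite ?inE// => p /AM[].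
by rewrite !ltr_norml => /andP[? ?] /andP[? ?]; split; rewrite /= in_itv/=; apply/andP.
Qed.

End PlaneMeasure.

(** * Bounded measurable functions on a set of finite measure *)

Section BoundedMeasurable.
Context {disp : measure_display} {T : measurableType disp} {R : realType}.
Variables (mu : {measure set T -> \bar R}) (U : set T).
Hypotheses (mU : measurable U) (Uoo : (mu U < +oo)%E).
Implicit Types f g : T -> R.

(** On a set of finite measure this implies integrability, and unlike integrability it is stable
    under products. *)
Definition bounded_measurable f :=
  measurable_fun U f /\ exists M, forall x, U x -> `|f x| <= M.

Lemma bounded_measurable_cst (c : R) : bounded_measurable (cst c).
Proof. by split; [exact: measurable_cst|exists `|c|]. Qed.

Lemma bounded_measurableD f g : bounded_measurable f -> bounded_measurable g ->
  bounded_measurable (fun x => f x + g x).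
Proof.
move=> [mf [M fM]] [mg [N gN]]; split; first exact: measurable_funD.
exists (M + N) => x Ux; apply: (le_trans (ler_normD _ _)).
by rewrite lerD ?fM ?gN.
Qed.

Lemma bounded_measurableM f g : bounded_measurable f -> bounded_measurable g ->
  bounded_measurable (fun x => f x * g x).
Proof.
move=> [mf [M fM]] [mg [N gN]]; split; first exact: measurable_funM.
by exists (M * N) => x Ux; rewrite normrM ler_pM ?fM ?gN.
Qed.

Lemma bounded_measurable_sum (I : Type) (r : seq I) (f : I -> T -> R) :
  (forall i, bounded_measurable (f i)) ->
  bounded_measurable (fun x => \sum_(i <- r) f i x).
Proof.
move=> bf; elim: r => [|i r IH].
  rewrite (_ : (fun _ => _) = cst 0); first exact: bounded_measurable_cst.
  by apply/funext => x; rewrite big_nil.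
rewrite (_ : (fun _ => _) = fun x => f i x + \sum_(j <- r) f j x).
  exact: bounded_measurableD.
by apply/funext => x; rewrite big_cons.
Qed.

Lemma bounded_measurable_integrable f : bounded_measurable f ->
  mu.-integrable U (EFin \o f).
Proof.
move=> [mf [M fM]]; apply: measurable_bounded_integrable => //.
exists M; split; first exact: num_real.
by move=> N MN x Ux; apply: (le_trans (fM x Ux)); apply: ltW.
Qed.

Lemma Rintegral_linear_sum (I : Type) (r : seq I) (c : I -> R) (f : I -> T -> R) :
  (forall i, bounded_measurable (f i)) ->
  (\int[mu]_(x in U) (\sum_(i <- r) c i * f i x) =
   \sum_(i <- r) c i * \int[mu]_(x in U) f i x)%R.
Proof.
move=> bf; elim: r => [|i r IH].
  rewrite big_nil (_ : (fun _ => _) = cst 0) ?Rintegral_cst ?mul0r//.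
  by apply/funext => x; rewrite big_nil.
have bcf j : bounded_measurable (fun x => c j * f j x).
  by apply: bounded_measurableM => //; exact: bounded_measurable_cst.
rewrite big_cons -IH -RintegralZl//; last exact: bounded_measurable_integrable.
rewrite -RintegralD//; try apply: bounded_measurable_integrable => //.
  by congr Rintegral; apply/funext => x; rewrite big_cons.
exact: bounded_measurable_sum.
Qed.

(** If the integral were zero, [f] would vanish almost everywhere on [U], so the set [V] would be
    contained in a null set. *)
Lemma Rintegral_gt0 f (V : set T) : bounded_measurable f ->
  (forall x, U x -> 0 <= f x) -> measurable V -> V `<=` U ->
  (0 < mu V)%E -> (forall x, V x -> 0 < f x) ->
  0 < (\int[mu]_(x in U) f x)%R.
Proof.
move=> bf f0 mV VU muV fV.
rewrite lt_neqAle Rintegral_ge0// andbT eq_sym; apply/negP => /eqP If0.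
have ifin : (\int[mu]_(x in U) (f x)%:E)%E \is a fin_num.
  by apply: integrable_fin_num => //; exact: bounded_measurable_integrable.
have : (\int[mu]_(x in U) `|(f x)%:E| = 0)%E.
  rewrite -[RHS]/(0%:E) -If0 /Rintegral fineK//.
  by apply: eq_integral => x; rewrite inE => /f0 fx; rewrite gee0_abs ?lee_fin.
have mf : measurable_fun U (EFin \o f) by apply/measurable_EFinP; case: bf.
move/(ae_eq_integral_abs mu mU mf) => -[N [mN N0 hN]].
have : (mu V <= mu N)%E.
  apply: le_measure; rewrite ?inE// => x Vx; apply: hN => /= fx0.
  have := fx0 (VU _ Vx) => -[] fx; have := fV _ Vx.
  by rewrite fx ltxx.
by rewrite N0 leNgt muV.
Qed.

End BoundedMeasurable.

Lemma bounded_measurable_seq_union {disp : measure_display}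
    {T : measurableType disp} {R : realType} (I : eqType) (F : I -> set T)
    (r : seq I) (f : T -> R) :
  (forall i, i \in r -> measurable (F i)) ->
  (forall i, i \in r -> bounded_measurable (F i) f) ->
  bounded_measurable (seq_union F r) f.
Proof.
move=> mF bf; split.
  by apply: measurable_fun_seq_union => // i /bf[].
elim: r bf {mF} => [|i r IH] bf; first by exists 0 => x [].
have [|M hM] := IH; first by move=> j jr; apply: bf; rewrite inE jr orbT.
have [_ [N hN]] := bf i (mem_head _ _).
exists (Num.max M N) => x [j]; rewrite inE le_max => /predU1P[->|jr] Fx.
  by rewrite hN ?orbT.
by rewrite hM//; exists j.
Qed.

(** * Barycentric coordinates *)

Section Triangle.
Context {R : realType}.
Implicit Types (u v p q : R * R) (P : 'I_3 -> R * R) (k : 'I_3).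

Definition cross u v : R := u.1 * v.2 - u.2 * v.1.

Let k0 : 'I_3 := @Ordinal 3 0 isT.
Let k1 : 'I_3 := @Ordinal 3 1 isT.
Let k2 : 'I_3 := @Ordinal 3 2 isT.

Let ordS3 : ((ordS k0 = k1) * (ordS k1 = k2) * (ordS k2 = k0))%type.
Proof. by do !split; apply/val_inj. Qed.

Let ord3 (k : 'I_3) : k = k0 \/ k = k1 \/ k = k2.
Proof.
by case: k => [[|[|[|//]]] ?]; [left|right; left|right; right]; apply/val_inj.
Qed.

Lemma ord3_cyclic_ind (Q : 'I_3 -> Prop) (k : 'I_3) :
  Q k -> Q (ordS k) -> Q (ordS (ordS k)) -> forall j, Q j.
Proof.
by case: (ord3 k) => [->|[->|->]]; rewrite !ordS3 => ? ? ? j;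
  case: (ord3 j) => [->|[->|->]].
Qed.

Lemma sum_ord3_cyclic (V : nmodType) (k : 'I_3) (F : 'I_3 -> V) :
  \sum_i F i = F k + F (ordS k) + F (ordS (ordS k)).
Proof.
have -> : \sum_i F i = F k0 + F k1 + F k2.
  rewrite !big_ord_recl big_ord0 addr0 addrA.
  by congr (F _ + F _ + F _); apply/val_inj.
case: (ord3 k) => [->|[->|->]]; rewrite !ordS3 //.
  by rewrite [RHS]addrC addrA.
by rewrite addrC addrA.
Qed.

(** Twice the signed area. The mesh triangles do not all have the same orientation, so the lemmas
    below ask only that it be nonzero. *)
Definition det_triangle P : R :=
  cross (P (ordS ord0) - P ord0) (P (ordS (ordS ord0)) - P ord0).

Lemma det_triangleE P k :
  det_triangle P = cross (P (ordS k) - P k) (P (ordS (ordS k)) - P k).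
Proof.
rewrite /det_triangle (_ : ord0 = k0); last exact/val_inj.
by case: (ord3 k) => [->|[->|->]]; rewrite !ordS3/cross /=; ring.
Qed.

(** The barycentric coordinate of [p] at vertex [k], as a ratio of signed areas; the quotient does
    not depend on the orientation. *)
Definition bary P k p : R :=
  cross (P (ordS k) - p) (P (ordS (ordS k)) - p) / det_triangle P.

Definition open_triangle P : set (R * R) := [set p | forall k, 0 < bary P k p].

Lemma ordS3K k : ordS (ordS (ordS k)) = k.
Proof. by case: (ord3 k) => [->|[->|->]]; rewrite !ordS3. Qed.

Lemma bary_affine P k p : bary P k p =
  cross (P (ordS k)) (P (ordS (ordS k))) / det_triangle P
  + ((P (ordS k)).2 - (P (ordS (ordS k))).2) / det_triangle P * p.1
  + ((P (ordS (ordS k))).1 - (P (ordS k)).1) / det_triangle P * p.2.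
Proof. by rewrite /bary /cross /=; ring. Qed.

Lemma measurable_open_triangle P :
  measurable (open_triangle P : set (measurableTypeR R * measurableTypeR R)).
Proof.
rewrite (_ : open_triangle P = \bigcap_k [set p | 0 < bary P k p]); last first.
  by apply/seteqP; split => p /= pP k; [move=> _; exact: pP|exact: pP].
apply: fin_bigcap_measurable => // k _.
have := measurable_affine setT
  (cross (P (ordS k)) (P (ordS (ordS k))) / det_triangle P)
  (((P (ordS k)).2 - (P (ordS (ordS k))).2) / det_triangle P)
  (((P (ordS (ordS k))).1 - (P (ordS k)).1) / det_triangle P).
move=> /(_ measurableT `]0, +oo[%classic (measurable_itv _)).
rewrite setTI; congr (measurable _); apply/seteqP.
by split => p /=; rewrite in_itv/= andbT bary_affine.
Qed.

Lemma open_open_triangle P : open (open_triangle P).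
Proof.
rewrite openE => p pP.
suff : \forall q \near p, forall k, 0 < bary P k q by [].
apply: (@filter_forall _ _ (fun k q => (0 < bary P k q) : Prop) (nbhs p) _) => k.
have : continuous (bary P k).
  rewrite (_ : bary P k = fun p => cross (P (ordS k)) (P (ordS (ordS k))) / det_triangle P
  + ((P (ordS k)).2 - (P (ordS (ordS k))).2) / det_triangle P * p.1
  + ((P (ordS (ordS k))).1 - (P (ordS k)).1) / det_triangle P * p.2); last first.
    by apply/funext => ?; rewrite bary_affine.
  move=> q; apply: cvgD; first apply: cvgD.
  - exact: cvg_cst.
  - by apply: cvgM; [exact: cvg_cst|exact: cvg_fst].
  - by apply: cvgM; [exact: cvg_cst|exact: cvg_snd].
move=> /(_ p) cb; apply: (cb [set x | 0 < x]).
by apply: open_nbhs_nbhs; split; [exact: open_gt|exact: pP].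
Qed.

Section Nondegenerate.
Variable P : 'I_3 -> R * R.
Hypothesis P0 : det_triangle P != 0.

Lemma bary_sum p : \sum_k bary P k p = 1.
Proof.
rewrite (sum_ord3_cyclic _ k0) /bary ordS3K -!mulrDl.
apply: (canLR (mulfK P0)); rewrite (det_triangleE P k0) mul1r /cross /=; ring.
Qed.

Lemma bary_comb p : p = \sum_k bary P k p *: P k.
Proof.
rewrite (sum_ord3_cyclic _ k0) /bary ordS3K.
have := P0; rewrite (det_triangleE P k0) /cross => D0.
by case: p => x y; congr pair; rewrite /= /GRing.scale /=;
  move: D0 => /=; set D := (X in X != 0); move=> D0; field.
Qed.

(** Uniqueness of barycentric coordinates: once [w k] is eliminated through the sum, a polynomial
    identity remains. *)
Lemma bary_hull (w : 'I_3 -> R) k : \sum_i w i = 1 ->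
  bary P k (\sum_i w i *: P i) = w k.
Proof.
rewrite !(sum_ord3_cyclic _ k) => w1.
have -> : w k = 1 - w (ordS k) - w (ordS (ordS k)) by rewrite -w1; ring.
rewrite /bary; apply: (canLR (mulfK P0)).
by rewrite (det_triangleE P k) /cross /= /GRing.scale /=; ring.
Qed.

End Nondegenerate.
End Triangle.

Section TriangleMore.
Context {R : realType}.
Implicit Types (u v p q : R * R) (P : 'I_3 -> R * R) (k : 'I_3).

Lemma hull_vertex n (P : 'I_n -> R * R) (k : 'I_n) : hull P (P k).
Proof.
exists (fun i => (i == k)%:R); split.
- by move=> i; rewrite ler0n.
- rewrite (bigD1 k)//= eqxx big1 ?addr0// => i /negPf ->; by [].
- rewrite (bigD1 k)//= eqxx scale1r big1 ?addr0// => i /negPf ->.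
  by rewrite scale0r.
Qed.

Lemma open_triangle_hull P : det_triangle P != 0 ->
  open_triangle P `<=` hull P.
Proof.
move=> P0 p pP; exists (bary P ^~ p); split.
- by move=> k; apply/ltW/pP.
- exact: bary_sum.
- exact: bary_comb.
Qed.

Lemma sum_fst n (F : 'I_n -> R * R) : (\sum_i F i).1 = \sum_i (F i).1.
Proof. by elim/big_ind2 : _ => // x1 x2 y1 y2 <- <-. Qed.

Lemma sum_snd n (F : 'I_n -> R * R) : (\sum_i F i).2 = \sum_i (F i).2.
Proof. by elim/big_ind2 : _ => // x1 x2 y1 y2 <- <-. Qed.

Lemma affine_on_open_triangle P (f : R * R -> R) p : det_triangle P != 0 ->
  affine_on (hull P) f -> open_triangle P p ->
  f p = \sum_k bary P k p * f (P k).
Proof.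
move=> P0 [a [b [c fE]]] pP; rewrite fE; last exact: open_triangle_hull.
under eq_bigr do rewrite (fE _ (hull_vertex _ _ _)) !mulrDr.
rewrite !big_split/= -mulr_suml bary_sum// mul1r.
rewrite {1 2}(bary_comb P P0 p) sum_fst sum_snd !mulr_sumr.
by congr (_ + _ + _); apply: eq_bigr => k _ /=; rewrite mulrCA.
Qed.

Lemma hull_open_triangle P p : det_triangle P != 0 -> hull P p ->
  open_triangle P p \/ exists k, bary P k p = 0.
Proof.
move=> P0 [w [w0 w1 ->]].
have [[k wk]|wk] := pselect (exists k, w k = 0).
  by right; exists k; rewrite bary_hull.
left => k; rewrite bary_hull// lt_neqAle w0 andbT eq_sym.
by apply/eqP => wk0; apply: wk; exists k.
Qed.

Lemma crossuu u : cross u u = 0. Proof. by rewrite /cross mulrC subrr. Qed.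

Lemma det_triangle_neq P k : det_triangle P != 0 -> P (ordS k) != P (ordS (ordS k)).
Proof. by apply: contraNneq; rewrite (det_triangleE P k) => ->; rewrite crossuu. Qed.

(** The full lines through the sides rather than the segments: they are still null and need only an
    equation. *)
Definition triangle_sides P : set (R * R) := [set p | exists k, bary P k p = 0].

Lemma triangle_sides_null P : det_triangle P != 0 ->
  measurable (triangle_sides P : set (measurableTypeR R * measurableTypeR R)) /\
  plane_measure (triangle_sides P) = 0%E.
Proof.
move=> P0.
pose L k : set (measurableTypeR R * measurableTypeR R) := [set p |
  ((P (ordS k)).2 - (P (ordS (ordS k))).2) / det_triangle P * p.1
  + ((P (ordS (ordS k))).1 - (P (ordS k)).1) / det_triangle P * p.2 =
  - (cross (P (ordS k)) (P (ordS (ordS k))) / det_triangle P)].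
have -> : triangle_sides P = seq_union L (enum 'I_3).
  apply/seteqP; split => p.
    move=> [k pk]; exists k; first by rewrite mem_enum.
    by move: pk; rewrite bary_affine /L /= => /eqP; rewrite -addrA addrC addr_eq0 => /eqP.
  move=> [k _ pk]; exists k; move: pk; rewrite bary_affine /L /= => pk.
  by rewrite -addrA pk subrr.
have mL k : measurable (L k) by exact: measurable_line.
split; first by apply: measurable_seq_union.
apply: measure_seq_union_eq0 => // k _; apply: plane_measure_line.
have := det_triangle_neq P k P0; rewrite -negb_and; apply: contraNN.
rewrite !mulf_eq0 !invr_eq0 (negPf P0) !orbF !subr_eq0 => /andP[/eqP e2 /eqP e1].
by apply/eqP; rewrite (surjective_pairing (P (ordS k))) e2 -e1 -surjective_pairing.
Qed.

Lemma open_triangle_nonempty P : det_triangle P != 0 -> open_triangle P !=set0.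
Proof.
move=> P0; exists (\sum_k 3^-1 *: P k) => k.
by rewrite bary_hull ?invr_gt0// (sum_ord3_cyclic _ k); lra.
Qed.

Lemma grad_affine (f : R * R -> R) p (a b c : R) :
  (\forall q \near p, f q = a + b * q.1 + c * q.2) -> grad f p = (b, c).
Proof.
move=> fE.
have dE (v : R * R) : 'D_v f p = b * v.1 + c * v.2.
  rewrite (near_eq_derive v fE) /derive.
  apply: cvg_lim => //.
  apply: (@cvg_trans _ ((b * v.1 + c * v.2) @[h --> (0:R)^'])); last exact: cvg_cst.
  apply: near_eq_cvg; near=> h.
  have h0 : h != 0 by near: h; exact: nbhs_dnbhs_neq.
  by rewrite /= /GRing.scale /=; field.
by rewrite /grad !dE /= !mulr0 !mulr1 addr0 add0r.
Unshelve. all: by end_near. Qed.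

(** Cauchy-Schwarz keeps the quotient in [-1, 1], where the cosine of its [acos] is the quotient
    itself; an angle between 0 and pi/2 has nonnegative cosine. *)
Lemma internal_angle_dot P k : internal_angle P k <= pi / 2 ->
  0 <= dot (P (ordS k) - P k) (P (ordS (ordS k)) - P k).
Proof.
rewrite /internal_angle; set u := _ - _; set v := _ - _ => /=.
have nn (w : R * R) : 0 <= euclidean_norm w by exact: sqrtr_ge0.
have dw (w : R * R) : 0 <= dot w w by rewrite /dot; nra.
have n2 (w : R * R) : euclidean_norm w ^+ 2 = dot w w by exact: sqr_sqrtr (dw w).
have CS : `|dot u v| <= euclidean_norm u * euclidean_norm v.
  rewrite -(@ler_pXn2r _ 2)// ?nnegrE ?mulr_ge0// exprMn !n2 real_normK ?num_real//.
  (* Lagrange's identity in the plane. *)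
  rewrite -subr_ge0 (_ : _ - _ = cross u v ^+ 2) ?sqr_ge0//.
  by rewrite /dot /cross; ring.
(* If an edge has length zero the angle is a default value, but Cauchy-Schwarz already gives a zero
   dot product. *)
have [uv0|] := eqVneq (euclidean_norm u * euclidean_norm v) 0.
  by move: CS; rewrite uv0 normr_le0 => /eqP ->.
move=> uv0 h.
have uvp : 0 < euclidean_norm u * euclidean_norm v
  by rewrite lt_neqAle eq_sym uv0 mulr_ge0.
set x := dot u v / _ in h.
have xB : -1 <= x <= 1.
  by rewrite -ler_norml normrM normfV (ger0_norm (ltW uvp)) ler_pdivrMr// mul1r.
have [/andP[a0 _] ax] := acos_def xB.
have : 0 <= x.
  rewrite -ax; apply: cos_ge0_pihalf; apply/andP; split => //.
  by apply: le_trans a0; rewrite lerNl oppr0 divr_ge0 ?pi_ge0.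
by rewrite /x pmulr_lge0 ?invr_gt0.
Qed.

Lemma cramer_fst (x y g : R * R) :
  g.1 * cross x y = y.2 * dot g x - x.2 * dot g y.
Proof. by rewrite /dot /cross; ring. Qed.

Lemma cramer_snd (x y g : R * R) :
  g.2 * cross x y = x.1 * dot g y - y.1 * dot g x.
Proof. by rewrite /dot /cross; ring. Qed.

(** [g], [h] is the basis dual to [x], [y], so its Gram matrix is the inverse of theirs; the
    determinant of the latter is the squared cross product. This turns a nonobtuse angle into a
    nonpositive product of gradients. *)
Lemma dual_basis_dot (x y g h : R * R) :
  dot g x = 1 -> dot g y = 0 -> dot h x = 0 -> dot h y = 1 ->
  dot g h * cross x y ^+ 2 = - dot x y.
Proof.
move=> gx gy hx hy.
rewrite {1}/dot mulrDl expr2 mulrACA cramer_fst cramer_fst mulrACA.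
rewrite cramer_snd cramer_snd gx gy hx hy /dot; ring.
Qed.

Lemma dot_basis_eq0 (x y g : R * R) : cross x y != 0 ->
  dot g x = 0 -> dot g y = 0 -> g = 0.
Proof.
move=> D0 gx gy; have := cramer_fst x y g; have := cramer_snd x y g.
rewrite gx gy !mulr0 subrr => /eqP; rewrite mulf_eq0 (negPf D0) orbF => /eqP g2.
move=> /eqP; rewrite mulf_eq0 (negPf D0) orbF => /eqP g1.
by rewrite (surjective_pairing g) g1 g2.
Qed.

End TriangleMore.

(** * The fourteen rays of the mesh *)

Section Rays.
Context {R : realType}.

(** Even indices are the inner directions and odd indices the outer ones. The index is not reduced;
    the period is 14. *)
Definition ray (k : nat) : R * R := (cos (k%:R * (pi / 7)), sin (k%:R * (pi / 7))).

Let c : R := cos (pi / 7).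
Let s : R := sin (pi / 7).

Lemma pi7_bounds : 0 < pi / 7 :> R /\ pi / 7 < pi / 2 :> R.
Proof. by have := @pi_gt0 R => ?; split; lra. Qed.

Lemma cos_pi7_gt0 : 0 < c.
Proof.
have [? ?] := pi7_bounds; apply: cos_gt0_pihalf; apply/andP; split => //.
by have := @pi_gt0 R => ?; lra.
Qed.

Lemma sin_pi7_gt0 : 0 < s.
Proof.
have [? ?] := pi7_bounds; apply: sin_gt0_pi; apply/andP; split => //.
by have := @pi_gt0 R => ?; lra.
Qed.

Lemma cos_pi7_lt1 : c < 1.
Proof.
have := sin_pi7_gt0; have := cos2Dsin2 (pi / 7 : R); rewrite -/c -/s.
by have := cos_pi7_gt0; nra.
Qed.

(** The two neighbours of a direction add up to 2 cos(pi/7) times it. This writes nearby nodes in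
    terms of two consecutive directions, so that later identities become polynomial. *)
Lemma rayS2 k : ray k.+2 = 2 * c *: ray k.+1 - ray k.
Proof.
have E2 : k.+2%:R * (pi / 7) = k.+1%:R * (pi / 7) + pi / 7 :> R.
  by rewrite (mulrSr _ k.+1); ring.
have E0 : k%:R * (pi / 7) = k.+1%:R * (pi / 7) - pi / 7 :> R.
  by rewrite (mulrSr _ k); ring.
rewrite /ray E2 E0 cosB sinB cosD sinD.
by congr pair; rewrite /= /GRing.scale /= -/c -/s; ring.
Qed.

Lemma cross_rayS k : cross (ray k) (ray k.+1) = s.
Proof.
rewrite /cross /= mulrC [X in _ - X]mulrC -sinB; congr sin.
by rewrite (mulrSr _ k); ring.
Qed.

Lemma rayD7 k : ray (k + 7) = - ray k.
Proof.
rewrite /ray natrD mulrDl (_ : 7%:R * (pi / 7) = pi :> R); last by field.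
by rewrite cosDpi sinDpi.
Qed.

Lemma ray_mod14 k n : ray (k + n * 14) = ray k.
Proof.
elim: n k => [|n IH] k; first by rewrite addn0.
by rewrite mulSn addnA IH (_ : 14 = 7 + 7)%N// addnA !rayD7 opprK.
Qed.

Lemma dot_ray m n : dot (ray m) (ray n) = cos (m%:R * (pi / 7) - n%:R * (pi / 7)).
Proof. by rewrite cosB. Qed.

(** The cosine decreases on [0, pi], which settles n at most 7; the other cases follow by replacing
    n with 14 - n. *)
Lemma cos_multiple_pi7 n : (0 < n < 14)%N -> cos (n%:R * (pi / 7)) <= c.
Proof.
have le7 m : (0 < m <= 7)%N -> cos (m%:R * (pi / 7)) <= c.
  move=> /andP[m0 m7].
  have m1 : 1 <= m%:R :> R by rewrite ler1n.
  have m7' : m%:R <= 7 :> R by rewrite (ler_nat _ m 7).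
  have p0 := @pi_gt0 R.
  rewrite leNgt ltr_cos ?in_itv/=; last first.
    1,2: by apply/andP; split; nra.
  by rewrite -leNgt; nra.
move=> /andP[n0 n14]; case: (leqP n 7) => n7; first by apply: le7; rewrite n0.
have -> : cos (n%:R * (pi / 7)) = cos ((14 - n)%:R * (pi / 7)) :> R.
  rewrite natrB; last exact: ltnW.
  rewrite -[LHS]cosN -[LHS](cosD2pi (- (n%:R * (pi / 7)))); congr cos.
  by rewrite mulrBl -mulr_natl; field.
by apply: le7; rewrite subn_gt0 n14 leq_subLR -[14%N]/(7 + 7)%N leq_add2r ltnW.
Qed.

(** Opposite parities exclude equal directions, so the angle is a nonzero multiple of pi/7 below a
    full turn. *)
Lemma dot_ray_le m n : (m < 14)%N -> (n < 14)%N -> odd m != odd n ->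
  dot (ray m) (ray n) <= c.
Proof.
move=> m14 n14 mn; rewrite dot_ray -mulrBl.
have [lt_mn|lt_nm|E] := ltngtP m n; last by rewrite E eqxx in mn.
- rewrite -cosN -mulNr opprB -natrB; last exact: ltnW.
  by apply: cos_multiple_pi7; rewrite subn_gt0 lt_mn (leq_ltn_trans (leq_subr _ _)).
- rewrite -natrB; last exact: ltnW.
  by apply: cos_multiple_pi7; rewrite subn_gt0 lt_nm (leq_ltn_trans (leq_subr _ _)).
Qed.

Lemma sign_change (f : nat -> R) a n : 0 <= f a -> f (a + n.+1)%N <= 0 ->
  exists2 k, (k < a + n.+1)%N & 0 <= f k /\ f k.+1 <= 0.
Proof.
elim: n => [|n IH] fa fan.
  by exists a; [rewrite addn1|split => //; rewrite -addn1].
have [h|h] := leP (f (a + n.+1)%N) 0.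
  by have [k ka hk] := IH fa h; exists k => //; rewrite addnS ltnW// ltnS.
by exists (a + n.+1)%N; [rewrite !addnS|split; [exact: ltW|rewrite -addnS]].
Qed.

(** The cross product of [ray k] with [p] changes sign under k -> k + 7, so within one turn it
    passes from nonnegative to nonpositive. There [p] lies between two consecutive rays. *)
Lemma wedge_decomposition (p : R * R) : exists2 k, (k < 14)%N &
  exists x y, [/\ 0 <= x, 0 <= y & p = x *: ray k + y *: ray k.+1].
Proof.
pose f k := cross (ray k) p.
have fD7 k : f (k + 7)%N = - f k.
  by rewrite /f rayD7 /cross /=; ring.
have [k k14 [fk fk1]] : exists2 k, (k < 14)%N & 0 <= f k /\ f k.+1 <= 0.
  have [f0|f0] := leP 0 (f 0%N).
    have [k k7 hk] : exists2 k, (k < 0 + 7)%N & 0 <= f k /\ f k.+1 <= 0.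
      by apply: sign_change => //; rewrite fD7 oppr_le0.
    by exists k => //; rewrite (leq_trans k7).
  apply: (sign_change f 7 6); first by rewrite (fD7 0) oppr_ge0 ltW.
  by rewrite fD7 (fD7 0) opprK ltW.
have s0 := sin_pi7_gt0.
(* Cramer's rule; the determinant of two consecutive rays is [s]. *)
exists k => //; exists (- f k.+1 / s), (f k / s); split.
- by rewrite divr_ge0 ?oppr_ge0// ltW.
- by rewrite divr_ge0// ltW.
have sE := cross_rayS k; rewrite -/s in sE.
have s0' : s != 0 by rewrite gt_eqF.
move: sE; rewrite /f /cross.
case: (ray k) (ray k.+1) p {f fD7 fk fk1} => [a1 a2] [b1 b2] [p1 p2] /= sE.
move: s0'; rewrite -sE => s0'.
by congr pair; rewrite /= /GRing.scale /=; field.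
Qed.

(** The weights are separate real variables, which suits [lra] and [nra] and makes reordering the
    points easy. *)
Definition hull3 (A B C p : R * R) := exists x y z,
  [/\ 0 <= x, 0 <= y, 0 <= z, x + y + z = 1 & p = x *: A + y *: B + z *: C].

Lemma hull3_swap A B C p : hull3 A B C p -> hull3 B A C p.
Proof.
move=> [x [y [z [x0 y0 z0 e ->]]]]; exists y, x, z; split => //.
  by rewrite -e; ring.
by rewrite [y *: _ + _]addrC.
Qed.

Lemma hull3_swapr A B C p : hull3 A B C p -> hull3 A C B p.
Proof.
move=> [x [y [z [x0 y0 z0 e ->]]]]; exists x, z, y; split => //.
  by rewrite -e; ring.
by rewrite addrAC.
Qed.

(* In the coordinates (x, y) of the wedge spanned by an inner direction a and a
   neighbouring outer direction b, the three triangles are cut out by the lines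
   x c + y = c and x + y / d = 1. *)
Lemma wedge_cover (d : R) (a b : R * R) (x y : R) : 1 < c * d ->
  0 <= x -> 0 <= y -> x + c * y <= c * d ->
  let p := x *: a + y *: b in
  let a' := 2 * c *: b - a in
  let b' := 2 * c *: a - b in
  [\/ hull3 0 a a' p, hull3 a a' (d *: b) p | hull3 (d *: b') (d *: b) a p].
Proof.
move=> cd1 x0 y0 hd p a' b'.
have c0 := cos_pi7_gt0; have c1 := cos_pi7_lt1.
have cn0 : c != 0 by rewrite gt_eqF.
have d0 : 0 < d by nra.
have dc : c < d by nra.
have [h1|h1] := leP (x * c + y) c.
  (* Since [a + a'] is 2c times [b], the term in [b] splits evenly between [a] and [a']. *)
  apply: Or31; exists (1 - x - y / c), (x + y / (2 * c)), (y / (2 * c)).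
  have E : y / c * c = y by rewrite divfK ?gt_eqF.
  have yc : 0 <= y / c by rewrite divr_ge0// ltW.
  have -> : y / (2 * c) = y / c / 2 by field; lra.
  split; [nra|lra|lra|lra|].
  rewrite /p /a' -{1}E scaler0 add0r; case: a b {p a' b'} => [a1 a2] [b1 b2].
  by congr pair; rewrite /= /GRing.scale /=; field.
have [h2|h2] := leP (x + y / d) 1.
  apply: Or32.
  (* The weight of [a']. The coefficient of [a] forces weight [x + be] on [a], and comparing
     coefficients of [b] then determines [be]. *)
  pose be := (1 - x - y / d) / (2 * (1 - c / d)).
  have cd : 0 < d - c by lra.
  have beE : be * (2 * (d - c)) = d - x * d - y.
    by rewrite /be; field; rewrite !gt_eqF.
  have yd : y / d * d = y by rewrite divfK ?gt_eqF.
  exists (x + be), be, (1 - x - 2 * be).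
  have be0 : 0 <= be by nra.
  split; [lra|lra|nra|lra|].
  have yE : y = 2 * c * be + d * (1 - x - 2 * be) by nra.
  rewrite /p /a' {1}yE; case: a b {p a' b'} => [a1 a2] [b1 b2].
  by congr pair; rewrite /= /GRing.scale /=; ring.
apply: Or33.
(* The weight of [d *: b']. The coefficient of [b] forces weight [al + y / d] on [d *: b], and
   comparing coefficients of [a] then determines [al]. *)
pose al := (x + y / d - 1) / (2 * (c * d - 1)).
have cd : 0 < c * d - 1 by lra.
have alE : al * (2 * (c * d - 1)) = x + y / d - 1.
  by rewrite /al; field; rewrite !gt_eqF.
have yd : y / d * d = y by rewrite divfK ?gt_eqF.
have al0 : 0 <= al by nra.
have yd0 : 0 <= y / d by rewrite divr_ge0// ltW.
exists al, (al + y / d), (1 - 2 * al - y / d).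
split; [lra|lra| |lra|].
  (* The weight of [a] is nonnegative exactly when the point is on the inner side of the heptagon's
     edge, which is [hd]. *)
  have : (1 - 2 * al - y / d) * (c * d - 1) = c * d - x - c * (y / d * d).
    by rewrite !mulrBl; have := alE; nra.
  rewrite yd => E; rewrite -(pmulr_lge0 _ cd) E; lra.
have xE : x = 2 * c * d * al + (1 - 2 * al - y / d) by nra.
rewrite /p /b' {1}xE; case: a b {p a' b'} => [a1 a2] [b1 b2].
by congr pair; rewrite /= /GRing.scale /=; field; rewrite gt_eqF.
Qed.

End Rays.

Lemma hull_hull {R : realType} n m (P : 'I_n -> R * R) (Q : 'I_m -> R * R) :
  (forall i, hull Q (P i)) -> hull P `<=` hull Q.
Proof.
move=> /choice[v vP] _ [w [w0 w1 ->]].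
exists (fun j => \sum_i w i * v i j); split.
- by move=> j; apply: sumr_ge0 => i _; rewrite mulr_ge0//; case: (vP i).
- rewrite exchange_big -[RHS]w1; apply: eq_bigr => i _.
  by rewrite -mulr_sumr; case: (vP i) => _ -> _; rewrite mulr1.
- under [RHS]eq_bigr do rewrite scaler_suml.
  rewrite exchange_big; apply: eq_bigr => i _.
  case: (vP i) => _ _ ->; rewrite scaler_sumr.
  by apply: eq_bigr => j _; rewrite scalerA.
Qed.

(** * The triangles of the mesh and the heptagon they cover *)

Section MeshGeometry.
Context {R : realType} (d : R).
Hypothesis cd1 : 1 < cos (pi / 7) * d.
Implicit Types (j : 'I_7) (t : 3.-tuple node_index).

Definition center_triangle j := [tuple origin_node; inner_node j; inner_node (ordS j)].
Definition inward_triangle j := [tuple inner_node j; inner_node (ordS j); outer_node j].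
Definition outward_triangle j :=
  [tuple outer_node j; outer_node (ordS j); inner_node (ordS j)].

Lemma trianglesP t : t \in triangles ->
  exists j, [\/ t = center_triangle j, t = inward_triangle j | t = outward_triangle j].
Proof.
rewrite /triangles !mem_cat => /or3P[] /mapP[j _ ->]; exists j.
- exact: Or31.
- exact: Or32.
- exact: Or33.
Qed.

Lemma center_triangle_in j : center_triangle j \in triangles.
Proof.
rewrite /triangles !mem_cat (map_f (fun j => center_triangle j)) ?mem_enum//.
Qed.

Lemma inward_triangle_in j : inward_triangle j \in triangles.
Proof.
by rewrite /triangles !mem_cat [X in _ || (X || _)](map_f (fun j => inward_triangle j))
  ?mem_enum ?orbT.
Qed.

Lemma outward_triangle_in j : outward_triangle j \in triangles.
Proof.
by rewrite /triangles !mem_cat [X in _ || (_ || X)](map_f (fun j => outward_triangle j))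
  ?mem_enum ?orbT.
Qed.

Lemma node_origin : node d origin_node = 0.
Proof.
by rewrite /node /origin_node -[lshift 7 _]/(unsplit (inl _)) unsplitK
  -[lshift 7 _]/(unsplit (inl _)) unsplitK.
Qed.

Lemma node_inner j : node d (inner_node j) = ray (2 * j).
Proof.
rewrite /node /inner_node -[lshift 7 _]/(unsplit (inl _)) unsplitK
  -[rshift 1 _]/(unsplit (inr _)) unsplitK.
by rewrite /inner_point /ray natrM !mulrA.
Qed.

Lemma node_outer j : node d (outer_node j) = d *: ray (2 * j).+1.
Proof.
rewrite /node /outer_node -[rshift _ _]/(unsplit (inr _)) unsplitK.
by rewrite /outer_point /ray (mulrSr 1 (2 * j)%N) natrM !mulrA.
Qed.

Lemma outer_pointE j : outer_point d j = d *: ray (2 * j).+1.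
Proof.
by rewrite -node_outer /node /outer_node -[rshift _ _]/(unsplit (inr _)) unsplitK.
Qed.

Lemma ray_ordS j k : ray (2 * ordS j + k) = ray (2 * j + k).+2 :> R * R.
Proof.
(* The quotient is 1 only for the last index, where the successor wraps to 0 and the ray index drops
   by a full turn. *)
have -> : (2 * j + k).+2 = (2 * ordS j + k + (j.+1 %/ 7) * 14)%N.
  by rewrite /=; lia.
by rewrite ray_mod14.
Qed.

Lemma ray_inner_ordS j : ray (2 * ordS j) = ray (2 * j).+2 :> R * R.
Proof. by rewrite -[(2 * ordS j)%N]addn0 ray_ordS addn0. Qed.

Lemma ray_outer_ordS j : ray (2 * ordS j).+1 = ray (2 * j).+3 :> R * R.
Proof. by rewrite -addn1 ray_ordS addn1. Qed.

Lemma node_innerS j : node d (inner_node (ordS j)) = ray (2 * j).+2.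
Proof. by rewrite node_inner ray_inner_ordS. Qed.

Lemma node_outerS j : node d (outer_node (ordS j)) = d *: ray (2 * j).+3.
Proof. by rewrite node_outer ray_outer_ordS. Qed.

Lemma d_gt0 : 0 < d.
Proof. by have c0 := @cos_pi7_gt0 R; have := cd1; nra. Qed.

Lemma vertices3 (a b e : node_index) : let P := vertices d [tuple a; b; e] in
  [/\ P ord0 = node d a, P (ordS ord0) = node d b & P (ordS (ordS ord0)) = node d e].
Proof. by []. Qed.

(** With c = cos(pi/7), the three families have determinants 2c, 2(c - d) and 2d(cd - 1) times
    sin(pi/7). The bound on d makes the last factor nonzero and also gives d > c. *)
Lemma det_triangle_neq0 t : t \in triangles -> det_triangle (vertices d t) != 0.
Proof.
have c0 := @cos_pi7_gt0 R; have c1 := @cos_pi7_lt1 R; have s0 := @sin_pi7_gt0 R.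
have d0 := d_gt0; have dc : cos (pi / 7) < d by have := cd1; nra.
move=> /trianglesP[j [] ->]; rewrite /det_triangle.
- have [-> -> ->] := vertices3 origin_node (inner_node j) (inner_node (ordS j)).
  rewrite node_origin node_innerS node_inner rayS2 !subr0.
  rewrite (_ : cross _ _ =
    2 * cos (pi / 7) * cross (ray (2 * j)) (ray (2 * j).+1)); last first.
    by rewrite /cross /= /GRing.scale /=; ring.
  by rewrite cross_rayS !mulf_neq0// gt_eqF.
- have [-> -> ->] := vertices3 (inner_node j) (inner_node (ordS j)) (outer_node j).
  rewrite node_innerS node_inner node_outer rayS2.
  rewrite (_ : cross _ _ =
    2 * (cos (pi / 7) - d) * cross (ray (2 * j)) (ray (2 * j).+1)); last first.
    by rewrite /cross /= /GRing.scale /=; ring.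
  by rewrite cross_rayS !mulf_neq0//; [rewrite lt_eqF ?subr_lt0|rewrite gt_eqF].
- have [-> -> ->] := vertices3 (outer_node j) (outer_node (ordS j)) (inner_node (ordS j)).
  rewrite node_innerS node_outerS node_outer.
  rewrite (rayS2 (2 * j).+1).
  rewrite (_ : cross _ _ =
    2 * d * (cos (pi / 7) * d - 1) * cross (ray (2 * j).+1) (ray (2 * j).+2)); last first.
    by rewrite /cross /= /GRing.scale /=; ring.
  by rewrite cross_rayS !mulf_neq0// gt_eqF ?subr_gt0.
Qed.

Lemma hull3_hull (a b e : node_index) p :
  hull3 (node d a) (node d b) (node d e) p -> hull (vertices d [tuple a; b; e]) p.
Proof.
move=> [x [y [z [x0 y0 z0 e1 ->]]]]; exists (tnth [tuple x; y; z]); split.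
- by case=> [[|[|[|//]]] ?]; rewrite (tnth_nth 0).
- by rewrite (sum_ord3_cyclic _ ord0) -e1.
- by rewrite (sum_ord3_cyclic _ ord0).
Qed.

(** Inner directions are the normals of the sides, at distance d cos(pi/7) from the origin. By
    linearity it suffices to check the corners, where [dot_ray_le] applies. *)
Lemma heptagon_dot_le p j : heptagon d p -> dot p (ray (2 * j)) <= cos (pi / 7) * d.
Proof.
move=> [w [w0 w1 ->]].
have -> : dot (\sum_i w i *: outer_point d i) (ray (2 * j)) =
    \sum_i w i * dot (outer_point d i) (ray (2 * j)).
  rewrite /dot sum_fst sum_snd !mulr_suml -big_split/=; apply: eq_bigr => i _.
  by rewrite /= /GRing.scale /=; ring.
rewrite -[leRHS]mul1r -[X in _ <= X * _]w1 mulr_suml; apply: ler_sum => i _.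
apply: ler_wpM2l; first exact: w0.
rewrite outer_pointE.
rewrite (_ : dot _ _ = dot (ray (2 * i).+1) (ray (2 * j)) * d); last first.
  by rewrite /dot /= /GRing.scale /=; ring.
rewrite ler_pM2r ?d_gt0//; apply: dot_ray_le.
- by have := ltn_ord i; lia.
- by have := ltn_ord j; lia.
- by rewrite /= !oddM.
Qed.

Lemma dot_wedge k (x y : R) :
  dot (x *: ray k + y *: ray k.+1) (ray k) = x + cos (pi / 7) * y /\
  dot (x *: ray k + y *: ray k.+1) (ray k.+1) = y + cos (pi / 7) * x.
Proof.
have n k' : dot (ray k') (ray k') = 1 :> R by rewrite dot_ray subrr cos0.
have kk : dot (ray k) (ray k.+1) = cos (pi / 7) :> R.
  by rewrite dot_ray -cosN; congr cos; rewrite (mulrSr _ k); ring.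
have dotE a b : dot (x *: a + y *: b) a = x * dot a a + y * dot a b /\
    dot (x *: a + y *: b) b = x * dot a b + y * dot b b.
  by rewrite /dot /= /GRing.scale /=; split; ring.
by have [-> ->] := dotE (ray k) (ray k.+1); rewrite !n kk; split; ring.
Qed.

(** Each wedge between consecutive rays has one inner and one outer boundary direction. The parity
    of [k] tells which comes first, and [wedge_cover] applies in either order. *)
Lemma heptagon_cover p : heptagon d p ->
  exists2 t, t \in triangles & hull (vertices d t) p.
Proof.
move=> hp; have [k k14 [x [y [x0 y0 pE]]]] := wedge_decomposition p.
have [j [kE|kE]] : exists j : 'I_7, k = (2 * j)%N \/ k = (2 * j).+1.
  have h : (k./2 < 7)%N by lia.
  by exists (Ordinal h) => /=; have := odd_double_half k; case: odd; lia.
(* The outward triangle with apex at inner node [j] is indexed by the predecessor of [j]. *)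
- have [i ij] : exists i : 'I_7, ordS i = j.
    by exists (ord_pred j); rewrite ord_predK.
  have hd : x + cos (pi / 7) * y <= cos (pi / 7) * d.
    by have := heptagon_dot_le _ j hp; rewrite -kE pE (dot_wedge k x y).1.
  have kS : ray k = ray (2 * i).+2 :> R * R.
    by rewrite kE -ij ray_inner_ordS.
  have kS1 : ray k.+1 = ray (2 * i).+3 :> R * R.
    by rewrite kE -ij ray_outer_ordS.
  have [] := wedge_cover d (ray k) (ray k.+1) x y cd1 x0 y0 hd; rewrite -pE => h.
  + exists (center_triangle j); first exact: center_triangle_in.
    by apply: hull3_hull; rewrite node_origin node_innerS node_inner -kE rayS2.
  + exists (inward_triangle j); first exact: inward_triangle_in.
    by apply: hull3_hull; rewrite node_innerS node_inner node_outer -kE rayS2.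
  + exists (outward_triangle i); first exact: outward_triangle_in.
    apply: hull3_hull; rewrite node_outerS node_outer node_innerS -kS -kS1.
    move: h; rewrite {1}kS1 [ray (2 * i).+3]rayS2 {1}kS.
    by rewrite opprB addrC subrK.
- have hd : y + cos (pi / 7) * x <= cos (pi / 7) * d.
    have := heptagon_dot_le _ (ordS j) hp.
    by rewrite ray_inner_ordS -kE pE (dot_wedge k x y).2.
  have := wedge_cover d (ray k.+1) (ray k) y x cd1 y0 x0 hd.
  rewrite [y *: _ + _]addrC -pE /= -rayS2 kE.
  have -> : 2 * cos (pi / 7) *: ray (2 * j).+1 - ray (2 * j).+2 = ray (2 * j) :> R * R.
    by rewrite rayS2 opprB addrC subrK.
  case=> h.
  + exists (center_triangle j); first exact: center_triangle_in.
    by apply: hull3_hull; rewrite node_origin node_innerS node_inner; apply: hull3_swapr.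
  + exists (inward_triangle j); first exact: inward_triangle_in.
    by apply: hull3_hull; rewrite node_innerS node_inner node_outer; apply: hull3_swap.
  + exists (outward_triangle j); first exact: outward_triangle_in.
    by apply: hull3_hull; rewrite node_outerS node_outer node_innerS; apply: hull3_swap.
Qed.

Lemma heptagon_hull3 (A B C p : R * R) :
  heptagon d A -> heptagon d B -> heptagon d C -> hull3 A B C p -> heptagon d p.
Proof.
move=> hA hB hC [x [y [z [x0 y0 z0 e ->]]]].
apply: (hull_hull 3 7 (tnth [tuple A; B; C])).
  by case=> [[|[|[|//]]] ?]; rewrite (tnth_nth 0).
exists (tnth [tuple x; y; z]); split.
- by case=> [[|[|[|//]]] ?]; rewrite (tnth_nth 0).
- by rewrite (sum_ord3_cyclic _ ord0) -e.
- by rewrite (sum_ord3_cyclic _ ord0).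
Qed.

Lemma heptagon_outer j : heptagon d (d *: ray (2 * j).+1).
Proof. by rewrite -outer_pointE; exact: hull_vertex. Qed.

(** Rays 1 and 13 add up to 2 cos(pi/7) times ray 0, and ray 7 is opposite to ray 0. Hence corners
    0, 6 and 3 balance with weights proportional to 1, 1 and 2 cos(pi/7). *)
Lemma heptagon_origin : heptagon d 0.
Proof.
have c0 := @cos_pi7_gt0 R; have d0 := d_gt0.
have h0 := heptagon_outer (@Ordinal 7 0 isT).
have h3 := heptagon_outer (@Ordinal 7 3 isT).
have h6 := heptagon_outer (@Ordinal 7 6 isT).
apply: (heptagon_hull3 _ _ _ _ h0 h6 h3).
set c := cos (pi / 7) in c0 *.
have cp : 0 < 2 + 2 * c by lra.
have E7 : ray (2 * 3).+1 = - ray 0 :> R * R by exact: (rayD7 0).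
have E13 : ray (2 * 6).+1 = 2 * c *: ray 0 - ray 1 :> R * R.
  have := @rayS2 R 13; rewrite (ray_mod14 0 1) (ray_mod14 1 1) => ->.
  by rewrite opprB addrC subrK.
exists (2 + 2 * c)^-1, (2 + 2 * c)^-1, (2 * c / (2 + 2 * c)).
have cn : 2 + 2 * c != 0 by rewrite gt_eqF.
split.
- by rewrite invr_ge0 ltW.
- by rewrite invr_ge0 ltW.
- by rewrite divr_ge0 ?mulr_ge0// ltW.
- by field.
rewrite /= E7 E13; case: (ray 0) (ray 1) => [a1 a2] [b1 b2].
by congr pair; rewrite /= /GRing.scale /=; field.
Qed.

(** The midpoint of two consecutive corners is d cos(pi/7) times the inner node between them. As
    this factor exceeds 1, the node lies between the origin and the midpoint. *)
Lemma heptagon_inner j : heptagon d (ray (2 * j)).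
Proof.
have c0 := @cos_pi7_gt0 R; have d0 := d_gt0.
have [i <-] : exists i : 'I_7, ordS i = j.
  by exists (ord_pred j); rewrite ord_predK.
have h := heptagon_outer i; have hS := heptagon_outer (ordS i).
apply: (heptagon_hull3 _ _ _ _ h hS heptagon_origin).
rewrite ray_inner_ordS ray_outer_ordS (rayS2 (2 * i).+1).
have cd1' := cd1; set c := cos (pi / 7) in c0 cd1' *.
have cn : c != 0 by rewrite gt_eqF.
have dn : d != 0 by rewrite gt_eqF.
have cdp : 0 < c * d by rewrite mulr_gt0.
exists (2 * (c * d))^-1, (2 * (c * d))^-1, (1 - (c * d)^-1); split.
- by rewrite invr_ge0 mulr_ge0// ltW.
- by rewrite invr_ge0 mulr_ge0// ltW.
- by rewrite subr_ge0 invf_le1// ltW.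
- by field; rewrite dn.
case: (ray (2 * i).+1) (ray (2 * i).+2) => [a1 a2] [b1 b2].
by congr pair; rewrite /= /GRing.scale /=; field; rewrite dn.
Qed.

Lemma hull_vertices_heptagon t : t \in triangles ->
  hull (vertices d t) `<=` heptagon d.
Proof.
move=> _; apply: hull_hull => k; rewrite /vertices.
case: (split_ordP (tnth t k)) => [m ->|j ->]; last first.
  by rewrite node_outer; exact: heptagon_outer.
case: (split_ordP m) => [z ->|j ->].
  by rewrite (ord1 z) node_origin; exact: heptagon_origin.
by rewrite node_inner; exact: heptagon_inner.
Qed.

Lemma heptagon_bounded p : heptagon d p -> `|p.1| < d + 1 /\ `|p.2| < d + 1.
Proof.
have d0 := d_gt0.
move=> [w [w0 w1 ->]]; rewrite sum_fst sum_snd.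
have bound (F : 'I_7 -> R) : (forall i, `|F i| <= 1) ->
    `|\sum_i w i * (d * F i)| < d + 1.
  move=> F1; rewrite -[in ltRHS](mulr1 d) -[in X in d * X]w1 mulr_sumr.
  apply: (@le_lt_trans _ _ (\sum_i d * w i)); last by rewrite ltrDl.
  apply: (le_trans (ler_norm_sum _ _ _)); apply: ler_sum => i _.
  rewrite !normrM (ger0_norm (w0 i)) (gtr0_norm d0) mulrCA.
  by rewrite ler_pM2l// -[leRHS]mulr1 ler_wpM2l ?w0.
have n1 x : `|cos x| <= 1 :> R by rewrite ler_norml cos_geN1 cos_le1.
have n2 x : `|sin x| <= 1 :> R by rewrite ler_norml sin_geN1 sin_le1.
by split; apply: bound.
Qed.

End MeshGeometry.

(** * Stiffness and mass matrices *)

Section FiniteElements.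
Context {R : realType} (d : R) (phi : node_index -> R * R -> R).
Hypothesis cd1 : 1 < cos (pi / 7) * d.
Hypothesis hphi : nodal_basis d phi.
Hypothesis hangle : forall t : 3.-tuple node_index, t \in triangles ->
  forall k : 'I_3, internal_angle (vertices d t) k <= pi / 2.
Implicit Types (i j : node_index) (t : 3.-tuple node_index) (p : R * R).

Let T t : set (R * R) := open_triangle (vertices d t).

Definition mesh_interior : set (R * R) := seq_union T triangles.

Let U := mesh_interior.

Lemma measurable_mesh_interior :
  measurable (U : set (measurableTypeR R * measurableTypeR R)).
Proof.
rewrite /U /mesh_interior; apply: measurable_seq_union.
by move=> t _; exact: measurable_open_triangle.
Qed.

Lemma mesh_interior_heptagon : U `<=` heptagon d.
Proof.
move=> p [t tT]; move=> /(open_triangle_hull _ (det_triangle_neq0 d cd1 t tT)).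
exact: hull_vertices_heptagon.
Qed.

Lemma mesh_interior_Omega : U `<=` Omega d.
Proof.
move=> p [t tT tp]; rewrite /Omega /interior /=.
apply: (@filterS _ _ _ (T t)); last first.
  by apply: open_nbhs_nbhs; split => //; exact: open_open_triangle.
by move=> q tq; apply: mesh_interior_heptagon; exists t.
Qed.

Lemma mesh_interior_finite : (plane_measure U < +oo)%E.
Proof.
apply: (bounded_plane_measure _ (d + 1)); first exact: measurable_mesh_interior.
by move=> p /mesh_interior_heptagon; exact: heptagon_bounded.
Qed.

Lemma area_integral_Omega (f : R * R -> R) :
  area_integral (Omega d) f = \int[plane_measure]_(p in U) f p.
Proof.
rewrite /area_integral /Rintegral; congr fine.
pose N : set (R * R) := seq_union (fun t => triangle_sides (vertices d t)) triangles.
have dN t : t \in triangles -> det_triangle (vertices d t) != 0.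
  exact: det_triangle_neq0.
apply: (integral_eq_off_null plane_measure (Omega d) U N).
- apply: measurable_seq_union.
  by move=> t /dN/triangle_sides_null[].
- by apply: measure_seq_union_eq0 => t /dN/triangle_sides_null[].
- exact: mesh_interior_Omega.
- move=> p /interior_subset/(heptagon_cover _ cd1)[t tT].
  move=> /(hull_open_triangle _ _ (dN t tT))[tp|tp]; [left|right]; by exists t.
Qed.

Lemma phi_vertices i t k : phi i (vertices d t k) = (i == tnth t k)%:R.
Proof. by have [_ _] := hphi i; apply. Qed.

(** On a triangle [phi i] is the barycentric coordinate of node [i], or zero if [i] is not a vertex;
    sign, size and support are read off from this. *)
Lemma phi_open_triangle i t p : t \in triangles -> T t p ->
  phi i p = \sum_k bary (vertices d t) k p * (i == tnth t k)%:R.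
Proof.
move=> tT tp; have [_ aff _] := hphi i.
rewrite (affine_on_open_triangle _ _ _ (det_triangle_neq0 d cd1 t tT) (aff t tT) tp).
by apply: eq_bigr => k _; rewrite phi_vertices.
Qed.

Lemma phi_ge0 i p : U p -> 0 <= phi i p.
Proof.
move=> [t tT tp]; rewrite (phi_open_triangle i t)//.
by apply: sumr_ge0 => k _; rewrite mulr_ge0 ?ler0n// ltW//; exact: tp.
Qed.

Lemma phi_le1 i p : U p -> phi i p <= 1.
Proof.
move=> [t tT tp]; rewrite (phi_open_triangle i t)//.
rewrite -[leRHS](bary_sum _ (det_triangle_neq0 d cd1 t tT) p); apply: ler_sum => k _.
by rewrite ler_piMr ?lern1 ?leq_b1// ltW//; exact: tp.
Qed.

Lemma phi_gt0 i t p : t \in triangles -> T t p -> i \in t -> 0 < phi i p.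
Proof.
move=> tT tp /tnthP[k ik]; rewrite (phi_open_triangle i t)// (bigD1 k)//= -ik eqxx mulr1.
apply: ltr_wpDr; last exact: tp.
by apply: sumr_ge0 => l _; rewrite mulr_ge0 ?ler0n// ltW//; exact: tp.
Qed.

Lemma phi_eq0 i t p : t \in triangles -> T t p -> i \notin t -> phi i p = 0.
Proof.
move=> tT tp it; rewrite (phi_open_triangle i t)// big1// => k _.
by case: eqP => [ik|]; rewrite ?mulr0//; rewrite ik mem_tnth in it.
Qed.

(** The constant gradient is described by its products with the edges, which are differences of
    nodal values; this is the form that [dual_basis_dot] takes. *)
Lemma grad_phi i t : t \in triangles -> exists2 g,
  forall p, T t p -> grad (phi i) p = g &
  forall k l, dot g (vertices d t k - vertices d t l) =
    (i == tnth t k)%:R - (i == tnth t l)%:R.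
Proof.
move=> tT; have [_ /(_ t tT)[a [b [c fE]]] _] := hphi i; exists (b, c).
  move=> p tp; apply: (grad_affine _ _ a).
  apply: (@filterS _ _ _ (T t)); last first.
    by apply: open_nbhs_nbhs; split => //; exact: open_open_triangle.
  by move=> q /(open_triangle_hull _ (det_triangle_neq0 d cd1 t tT)); exact: fE.
by move=> k l; rewrite -!phi_vertices !fE; [rewrite /dot /=; ring|exact: hull_vertex..].
Qed.

Lemma tnth_triangle_neq t k : t \in triangles ->
  tnth t (ordS k) != tnth t (ordS (ordS k)).
Proof.
move=> tT; have := det_triangle_neq _ k (det_triangle_neq0 d cd1 t tT).
by apply: contraNneq => e; rewrite /vertices e.
Qed.

Lemma grad_phi_eq0 i t p : t \in triangles -> T t p -> i \notin t -> grad (phi i) p = 0.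
Proof.
move=> tT tp it; have [g /(_ p tp) -> gE] := grad_phi i t tT.
have nik k : (i == tnth t k) = false.
  by apply/negP => /eqP ik; rewrite ik mem_tnth in it.
apply: (dot_basis_eq0 _ _ _ (det_triangle_neq0 d cd1 t tT));
by rewrite gE !nik subrr.
Qed.

(** The gradients belonging to two vertices of a triangle are dual to the edges leaving the third.
    Their product has the sign opposite to that of the dot product of these edges, which is
    nonnegative for a nonobtuse angle. *)
Lemma dot_grad_phi_le0 i j p : i != j -> U p ->
  dot (grad (phi j) p) (grad (phi i) p) <= 0.
Proof.
move=> ij [t tT tp].
have dotC u v : dot u v = dot v u :> R by rewrite /dot; ring.
have d0 (u : R * R) : dot 0 u = 0 by rewrite /dot /=; ring.
have [it|it] := boolP (i \in t); last by rewrite (grad_phi_eq0 i t)// dotC d0.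
have [jt|jt] := boolP (j \in t); last by rewrite (grad_phi_eq0 j t)// d0.
(* Here [k] is the third vertex, opposite to the pair considered. *)
have key k : dot (grad (phi (tnth t (ordS k))) p)
    (grad (phi (tnth t (ordS (ordS k)))) p) <= 0.
  have [g /(_ p tp) -> gE] := grad_phi (tnth t (ordS k)) t tT.
  have [h /(_ p tp) -> hE] := grad_phi (tnth t (ordS (ordS k))) t tT.
  have n1 := tnth_triangle_neq t k tT.
  have n2 := tnth_triangle_neq t (ordS k) tT.
  have n3 := tnth_triangle_neq t (ordS (ordS k)) tT.
  rewrite !ordS3K in n2 n3.
  set x := vertices d t (ordS k) - vertices d t k.
  set y := vertices d t (ordS (ordS k)) - vertices d t k.
  have D0 := det_triangle_neq0 d cd1 t tT; rewrite (det_triangleE _ k) in D0.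
  have := dual_basis_dot x y g h.
  rewrite !gE !hE !eqxx (negPf n1) (negPf n2) [tnth t (ordS k) == _]eq_sym (negPf n3).
  rewrite [_ == tnth t (ordS k)]eq_sym (negPf n1).
  rewrite !subrr !subr0 => /(_ erefl erefl erefl erefl) E.
  have c2 : 0 < cross x y ^+ 2 by rewrite exprn_even_gt0.
  rewrite -(pmulr_lle0 _ c2) E oppr_le0.
  exact: internal_angle_dot (hangle t tT k).
move: it jt ij => /tnthP[k ->] /tnthP[l ->].
suff : forall l, tnth t k != tnth t l ->
    dot (grad (phi (tnth t l)) p) (grad (phi (tnth t k)) p) <= 0.
  exact.
apply: (ord3_cyclic_ind _ k) => [|_|_]; first by rewrite eqxx.
- by have := key (ordS (ordS k)); rewrite !ordS3K dotC.
- by have := key (ordS k); rewrite !ordS3K.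
Qed.

Let mU := measurable_mesh_interior.
Let Uoo := mesh_interior_finite.

Let measurable_T t : measurable (T t : set (measurableTypeR R * measurableTypeR R)).
Proof. exact: measurable_open_triangle. Qed.

Let T_sub_U t : t \in triangles -> T t `<=` U.
Proof. by move=> tT p tp; exists t. Qed.

Let T_nonempty t : t \in triangles -> exists p, T t p.
Proof. by move=> tT; exact: open_triangle_nonempty (det_triangle_neq0 d cd1 t tT). Qed.

Let T_measure_gt0 t : t \in triangles -> (0 < plane_measure (T t))%E.
Proof.
move=> tT; have [p tp] := T_nonempty t tT.
apply: (nbhs_plane_measure_gt0 _ p) => //.
by apply: open_nbhs_nbhs; split => //; exact: open_open_triangle.
Qed.

Let good (f : R * R -> R) :=
  bounded_measurable (U : set (measurableTypeR R * measurableTypeR R)) f.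

Lemma bounded_measurable_phi i : good (phi i).
Proof.
split; last first.
  by exists 1 => p pU; rewrite ger0_norm ?phi_ge0 ?phi_le1.
apply: measurable_fun_seq_union => // t tT.
have [_ /(_ t tT)[a [b [c fE]]] _] := hphi i.
apply: (eq_measurable_fun (fun p => a + b * p.1 + c * p.2)).
  move=> p; rewrite inE => /(open_triangle_hull _ (det_triangle_neq0 d cd1 t tT)) tp.
  by rewrite fE.
exact: measurable_affine.
Qed.

Lemma bounded_measurable_grad_phi i :
  good (fun p => (grad (phi i) p).1) /\ good (fun p => (grad (phi i) p).2).
Proof.
have loc (proj : R * R -> R) t : t \in triangles ->
    bounded_measurable (T t : set (measurableTypeR R * measurableTypeR R))
      (fun p => proj (grad (phi i) p)).
  move=> tT; have [g gE _] := grad_phi i t tT; split; last first.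
    by exists `|proj g| => p tp; rewrite gE.
  apply: (eq_measurable_fun (cst (proj g))); last exact: measurable_cst.
  by move=> p; rewrite inE => tp; rewrite gE.
split.
- by apply: bounded_measurable_seq_union => // t tT; exact: (loc fst).
- by apply: bounded_measurable_seq_union => // t tT; exact: (loc snd).
Qed.

Let good_dot (F G : R * R -> R * R) :
  good (fun p => (F p).1) -> good (fun p => (F p).2) ->
  good (fun p => (G p).1) -> good (fun p => (G p).2) ->
  good (fun p => dot (F p) (G p)).
Proof.
by move=> *; apply: bounded_measurableD => //; apply: bounded_measurableM.
Qed.

Let good_dot_grad i j : good (fun p => dot (grad (phi j) p) (grad (phi i) p)).
Proof.
by have [? ?] := bounded_measurable_grad_phi i;
  have [? ?] := bounded_measurable_grad_phi j; exact: good_dot.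
Qed.

Let good_phiM i j : good (fun p => phi j p * phi i p).
Proof. by apply: bounded_measurableM => //; exact: bounded_measurable_phi. Qed.

Lemma stiffnessE i j : stiffness d phi i j =
  \int[plane_measure]_(p in U) dot (grad (phi j) p) (grad (phi i) p).
Proof. by rewrite mxE area_integral_Omega. Qed.

Lemma massE i j : mass d phi i j =
  \int[plane_measure]_(p in U) (phi j p * phi i p).
Proof. by rewrite mxE area_integral_Omega. Qed.

Lemma stiffness_le0 i j : i != j -> stiffness d phi i j <= 0.
Proof.
move=> ij; rewrite stiffnessE.
rewrite -[leRHS](mul0r (fine (plane_measure U))) -(Rintegral_cst _ mU).
apply: le_Rintegral => //.
- exact: bounded_measurable_integrable (good_dot_grad i j).
- by apply: bounded_measurable_integrable => //; exact: bounded_measurable_cst.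
- by move=> p pU; exact: dot_grad_phi_le0.
Qed.

Definition mesh_adjacent i j := exists2 t, t \in triangles & (i \in t) && (j \in t).

Lemma mass_gt0 i j : mesh_adjacent i j -> 0 < mass d phi i j.
Proof.
move=> [t tT /andP[it jt]]; rewrite massE.
apply: (Rintegral_gt0 _ _ mU Uoo _ (T t)) => //.
- exact: good_phiM.
- by move=> p pU; rewrite mulr_ge0 ?phi_ge0.
- exact: T_sub_U.
- exact: T_measure_gt0.
- by move=> p tp; rewrite mulr_gt0 ?(phi_gt0 _ t).
Qed.

Lemma stiffness_mass_eq0 i j : ~ mesh_adjacent i j ->
  stiffness d phi i j = 0 /\ mass d phi i j = 0.
Proof.
move=> nij; rewrite stiffnessE massE.
have I0 f : (forall p, U p -> f p = 0) -> \int[plane_measure]_(p in U) f p = 0.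
  move=> f0; rewrite (@eq_Rintegral _ _ _ _ _ (cst 0)) ?Rintegral_cst ?mul0r//.
  by move=> p; rewrite inE => /f0.
have c t : t \in triangles -> i \notin t \/ j \notin t.
  move=> tT; have [it|] := boolP (i \in t); last by left.
  have [jt|] := boolP (j \in t); last by right.
  by exfalso; apply: nij; exists t => //; rewrite it.
split; apply: I0 => p [t tT tp]; case: (c t tT) => nt.
- by rewrite (grad_phi_eq0 i t)// /dot /= !mulr0 addr0.
- by rewrite (grad_phi_eq0 j t)// /dot /= !mul0r addr0.
- by rewrite (phi_eq0 i t) ?mulr0.
- by rewrite (phi_eq0 j t) ?mul0r.
Qed.

(** * Quadratic forms of the matrices as integrals *)

Section QuadraticForm.
Variables (I : finType) (h : I -> node_index) (u : I -> R).

(** The finite element function with coefficients [u] at the nodes [h]; [Dv] below is its gradient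
    on the open triangles. In the application [h] embeds the interior nodes. *)
Let v p : R := \sum_k u k * phi (h k) p.
Let Dv p : R * R := (\sum_k u k * (grad (phi (h k)) p).1,
  \sum_k u k * (grad (phi (h k)) p).2).

Let good_sum (f : node_index -> R * R -> R) : (forall i, good (f i)) ->
  good (fun p => \sum_k u k * f (h k) p).
Proof.
move=> gf; apply: bounded_measurable_sum => // k.
apply: bounded_measurableM; [exact: bounded_measurable_cst|exact: gf].
Qed.

Let quadratic_formE (B : node_index -> node_index -> R * R -> R) :
  (forall i j, good (B i j)) ->
  \sum_k u k * \sum_l \int[plane_measure]_(p in U) B (h k) (h l) p * u l =
  \int[plane_measure]_(p in U) (\sum_k u k * \sum_l u l * B (h k) (h l) p).
Proof.
have int_sum := Rintegral_linear_sum plane_measure U mU Uoo.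
move=> gB; rewrite int_sum; last by move=> k; exact: good_sum.
apply: eq_bigr => k _; congr (_ * _); rewrite int_sum; last by move=> l; exact: gB.
by apply: eq_bigr => l _; rewrite mulrC.
Qed.

Lemma stiffness_quadratic_form :
  \sum_k u k * \sum_l stiffness d phi (h k) (h l) * u l =
  \int[plane_measure]_(p in U) dot (Dv p) (Dv p).
Proof.
under eq_bigr do under eq_bigr do rewrite stiffnessE.
rewrite (quadratic_formE (fun i j p => dot (grad (phi j) p) (grad (phi i) p)))//.
congr Rintegral; apply/funext => p; rewrite /dot /Dv /=.
under eq_bigr do under eq_bigr do rewrite mulrDr.
under eq_bigr do rewrite big_split mulrDr.
rewrite big_split /= !mulr_suml; congr (_ + _); apply: eq_bigr => k _.
  by rewrite !mulr_sumr; apply: eq_bigr => l _; ring.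
by rewrite !mulr_sumr; apply: eq_bigr => l _; ring.
Qed.

Lemma mass_quadratic_form :
  \sum_k u k * \sum_l mass d phi (h k) (h l) * u l =
  \int[plane_measure]_(p in U) (v p * v p).
Proof.
under eq_bigr do under eq_bigr do rewrite massE.
rewrite (quadratic_formE (fun i j p => phi j p * phi i p))//.
congr Rintegral; apply/funext => p; rewrite /v mulr_suml.
apply: eq_bigr => k _; rewrite !mulr_sumr; apply: eq_bigr => l _; ring.
Qed.

(** [Dv] is constant on an open triangle, so one nonzero value makes the integrand positive on a set
    of positive area. *)
Lemma stiffness_form_gt0 t p : t \in triangles -> T t p -> Dv p != 0 ->
  0 < \sum_k u k * \sum_l stiffness d phi (h k) (h l) * u l.
Proof.
move=> tT tp Dp; rewrite stiffness_quadratic_form.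
have dd w : 0 <= dot w w :> R by rewrite /dot; nra.
apply: (Rintegral_gt0 _ _ mU Uoo _ (T t)) => //.
- have g1 := good_sum (fun i p => (grad (phi i) p).1)
    (fun i => (bounded_measurable_grad_phi i).1).
  have g2 := good_sum (fun i p => (grad (phi i) p).2)
    (fun i => (bounded_measurable_grad_phi i).2).
  exact: (good_dot Dv Dv g1 g2 g1 g2).
- exact: T_sub_U.
- exact: T_measure_gt0.
move=> q tq; have -> : Dv q = Dv p.
  congr pair; apply: eq_bigr => k _; have [g gE _] := grad_phi (h k) t tT;
  by rewrite !gE.
rewrite lt_neqAle dd andbT eq_sym; apply: contraNneq Dp => /eqP.
rewrite /dot paddr_eq0 -?expr2 ?sqr_ge0// !sqrf_eq0 => /andP[/eqP e1 /eqP e2].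
by rewrite (surjective_pairing (Dv p)) e1 e2.
Qed.

(** Without energy the gradient vanishes on the triangle. The two sums are the values of [v] at two
    vertices, and their difference is the product of [Dv] with the edge joining them. *)
Lemma stiffness_form_eq0 t : t \in triangles ->
  \sum_k u k * \sum_l stiffness d phi (h k) (h l) * u l <= 0 ->
  forall a b, \sum_k u k * (h k == tnth t a)%:R = \sum_k u k * (h k == tnth t b)%:R.
Proof.
move=> tT le0 a b; have [p tp] := T_nonempty t tT.
have [Dp|Dp] := eqVneq (Dv p) 0; last first.
  by have := stiffness_form_gt0 t p tT tp Dp; rewrite ltNge le0.
apply/eqP; rewrite -subr_eq0 -sumrB; apply/eqP.
set w := vertices d t a - vertices d t b.
transitivity (dot (Dv p) w); last by rewrite Dp /dot /= !mul0r addr0.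
rewrite /dot /Dv /= !mulr_suml -big_split/=; apply: eq_bigr => k _.
have [g gE gd] := grad_phi (h k) t tT.
by rewrite -mulrBr -gd -(gE p tp) /dot /=; ring.
Qed.

End QuadraticForm.

End FiniteElements.

(** * Adjacency of nodes and unique continuation *)

Lemma inner_node_inj : injective inner_node.
Proof. by move=> j k /lshift_inj/rshift_inj. Qed.

Lemma outer_node_inj : injective outer_node.
Proof. by move=> j k /rshift_inj. Qed.

Lemma outer_neq_inner (j k : 'I_7) : (outer_node j == inner_node k) = false.
Proof. by rewrite /outer_node /inner_node eq_rlshift. Qed.

Lemma outer_neq_origin (j : 'I_7) : (outer_node j == origin_node) = false.
Proof. by rewrite /outer_node /origin_node eq_rlshift. Qed.

Lemma inner_neq_origin (j : 'I_7) : (inner_node j == origin_node) = false.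
Proof. by rewrite /inner_node /origin_node (inj_eq (@lshift_inj _ _)) eq_rlshift. Qed.

(** Outer node [j] lies on inward triangle [j] and on two outward triangles, whose apexes are again
    inner nodes [j] and [ordS j]. Thus a boundary row has only two nonzero entries. *)
Lemma adjacent_outer_inner (j k : 'I_7) :
  mesh_adjacent (outer_node j) (inner_node k) <-> k = j \/ k = ordS j.
Proof.
split=> [[t /trianglesP[m [] ->]]|[]->].
- by rewrite !inE outer_neq_origin !outer_neq_inner.
- rewrite !inE !outer_neq_inner (inj_eq outer_node_inj) => /andP[/eqP ->].
  rewrite !(inj_eq inner_node_inj) [inner_node k == _]eq_sym outer_neq_inner orbF.
  by case/orP => /eqP ->; [left|right].
- rewrite !inE outer_neq_inner !(inj_eq outer_node_inj) (inj_eq inner_node_inj).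
  rewrite ![inner_node k == _]eq_sym !outer_neq_inner /= orbF.
  by move=> /andP[/orP[] /eqP -> /eqP ->]; [right|left].
- exists (inward_triangle j); first exact: inward_triangle_in.
  by rewrite !inE !eqxx ?orbT.
- exists (inward_triangle j); first exact: inward_triangle_in.
  by rewrite !inE !eqxx ?orbT.
Qed.

Lemma not_adjacent_outer_origin (j : 'I_7) : ~ mesh_adjacent (outer_node j) origin_node.
Proof.
move=> [t /trianglesP[m [] ->]].
- by rewrite !inE outer_neq_origin !outer_neq_inner.
- by rewrite !inE ![origin_node == _]eq_sym !inner_neq_origin !outer_neq_origin andbF.
- by rewrite !inE ![origin_node == _]eq_sym !inner_neq_origin !outer_neq_origin andbF.
Qed.

Lemma adjacent_inner_origin (j : 'I_7) : mesh_adjacent (inner_node j) origin_node.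
Proof.
exists (center_triangle j); first exact: center_triangle_in.
by rewrite !inE !eqxx ?orbT.
Qed.

Lemma ordS7_neq (j : 'I_7) : ordS j != j.
Proof. by rewrite -val_eqE /=; have := ltn_ord j; lia. Qed.

Lemma iter7_ordS (j : 'I_7) : iter 7 (@ordS 7) j = j.
Proof. by apply/val_inj => /=; have := ltn_ord j; lia. Qed.

(* Each step reverses the sign and 7 is odd. *)
Lemma alternating_cycle_eq0 {R : realType} (c c' x : 'I_7 -> R) :
  (forall j, c j < 0) -> (forall j, c' j < 0) ->
  (forall j, c j * x j + c' j * x (ordS j) = 0) -> forall j, x j = 0.
Proof.
move=> c0 c'0 E.
have pos j : 0 < x j -> x (ordS j) < 0.
  by move=> xj; have := E j; have := c0 j; have := c'0 j; nra.
have neg j : x j < 0 -> 0 < x (ordS j).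
  by move=> xj; have := E j; have := c0 j; have := c'0 j; nra.
move=> j; apply/eqP; rewrite eq_le !leNgt; apply/andP; split; apply/negP => xj.
- have := pos _ (neg _ (pos _ (neg _ (pos _ (neg _ (pos _ xj)))))).
  by rewrite [ordS _](iter7_ordS j) ltNge ltW.
- have := neg _ (pos _ (neg _ (pos _ (neg _ (pos _ (neg _ xj)))))).
  by rewrite [ordS _](iter7_ordS j) ltNge ltW.
Qed.

Theorem mainTheorem5 (R : realType) (d : R) (phi : node_index -> R * R -> R)
    (hd : (cos (pi / 7))^-1 < d)
    (hphi : nodal_basis d phi)
    (hangle : forall t : 3.-tuple node_index, t \in triangles ->
       forall k : 'I_3, internal_angle (vertices d t) k <= pi / 2) :
  forall lambda : R, S_in d phi lambda = [set 0].
Proof.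
move=> lambda.
have c0 := @cos_pi7_gt0 R.
have cd1 : 1 < cos (pi / 7) * d by rewrite -ltr_pdivrMl// mulr1.
apply/seteqP; split => [u|_ ->]; last by split; rewrite /= mulmx0.
set A := stiffness d phi; set M := mass d phi.
move=> [/= uI uB].
have rowI i : \sum_l
    (A (lshift 7 i) (lshift 7 l) - lambda * M (lshift 7 i) (lshift 7 l)) * u l ord0 = 0.
  have := congr1 (fun w : 'cV[R]_(1 + 7) => w i ord0) uI; rewrite !mxE => E.
  by rewrite -[RHS]E; apply: eq_bigr => l _; rewrite !mxE.
have rowB j : \sum_l
    (A (outer_node j) (lshift 7 l) - lambda * M (outer_node j) (lshift 7 l)) * u l ord0 = 0.
  have := congr1 (fun w : 'cV[R]_7 => w j ord0) uB; rewrite !mxE => E.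
  by rewrite -[RHS]E; apply: eq_bigr => l _; rewrite !mxE.
pose x j := u (rshift 1 j) ord0; pose x0 := u (lshift 7 ord0) ord0.
suff [x00 xj0] : x0 = 0 /\ forall j, x j = 0.
  apply/matrixP => i k; rewrite (ord1 k) mxE.
  case: (split_ordP i) => [z ->|j ->]; last exact: xj0.
  by rewrite (ord1 z); exact: x00.
have coef_lt0 i j : 0 < lambda -> i != j -> mesh_adjacent i j ->
    A i j - lambda * M i j < 0.
  move=> l0 ij aij; have := stiffness_le0 d phi cd1 hphi hangle i j ij.
  by have := mass_gt0 d phi cd1 hphi i j aij; rewrite -/A -/M; nra.
have [l0|l0] := ltP 0 lambda; last first.
  pose y l := u l ord0.
  (* Pair the interior equations with [u] itself. *)
  have EA : \sum_k y k * \sum_l A (lshift 7 k) (lshift 7 l) * y l =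
      lambda * \sum_k y k * \sum_l M (lshift 7 k) (lshift 7 l) * y l.
    rewrite mulr_sumr; apply: eq_bigr => k _; rewrite mulrCA; congr (_ * _).
    apply/eqP; rewrite -subr_eq0 mulr_sumr -sumrB -[X in _ == X](rowI k); apply/eqP.
    by apply: eq_bigr => l _; rewrite /y; ring.
  have A0 : \sum_k y k * \sum_l A (lshift 7 k) (lshift 7 l) * y l <= 0.
    rewrite EA mulr_le0_ge0// (mass_quadratic_form d phi cd1 hphi _ (lshift 7) y).
    by apply: Rintegral_ge0 => p _; rewrite -expr2 sqr_ge0.
  (* The energy is nonpositive, so the function takes equal values at the vertices of each triangle.
     Zero values spread from the outer nodes to the inner ones through inward triangles, then to the
     origin through a center triangle. *)
  have eqv t := stiffness_form_eq0 d phi cd1 hphi _ (lshift 7) y t ^~ A0.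
  have at_interior i : \sum_k y k * (lshift 7 k == lshift 7 i :> node_index)%:R = y i.
    rewrite (bigD1 i)//= eqxx mulr1 big1 ?addr0// => k ki.
    by rewrite (inj_eq (@lshift_inj _ _)) (negPf ki) mulr0.
  have at_outer j : \sum_k y k * (lshift 7 k == outer_node j)%:R = 0.
    by rewrite big1// => k _; rewrite eq_lrshift mulr0.
  have xj0 j : x j = 0.
    have := eqv _ (inward_triangle_in j) ord0 (ordS (ordS ord0)).
    by rewrite at_outer at_interior.
  split => //.
  have := eqv _ (center_triangle_in ord0) ord0 (ordS ord0).
  by rewrite !at_interior => e; exact: etrans e (xj0 ord0).
have xj0 : forall j, x j = 0.
  apply: (alternating_cycle_eq0
    (fun j => A (outer_node j) (inner_node j) - lambda * M (outer_node j) (inner_node j))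
    (fun j => A (outer_node j) (inner_node (ordS j)) -
      lambda * M (outer_node j) (inner_node (ordS j)))) => j.
  - by apply: coef_lt0; rewrite ?outer_neq_inner//; apply/adjacent_outer_inner; left.
  - by apply: coef_lt0; rewrite ?outer_neq_inner//; apply/adjacent_outer_inner; right.
  (* Row [j] of the boundary equations reduces to the terms of inner nodes [j] and [ordS j], which
     are distinct. *)
  have := rowB j; rewrite big_split_ord big_ord1 /=.
  have [-> ->] := stiffness_mass_eq0 d phi cd1 hphi _ _ (not_adjacent_outer_origin j).
  rewrite mulr0 subrr mul0r add0r (bigD1 j)//=.
  rewrite (bigD1 (ordS j)) ?ordS7_neq//= big1 ?addr0//.
  move=> k /andP[kj kSj].
  have [|-> ->] := stiffness_mass_eq0 d phi cd1 hphi (outer_node j) (inner_node k).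
    by move/adjacent_outer_inner => -[] /eqP; apply/negP.
  by rewrite mulr0 subrr mul0r.
split => //.
(* With the inner values zero, the row of inner node 0 keeps only the origin term, whose coefficient
   is negative. *)
have := rowI (rshift 1 ord0); rewrite big_split_ord big_ord1 /= big1 ?addr0; last first.
  by move=> k _; rewrite -/(x k) xj0 mulr0.
move/eqP; rewrite mulf_eq0 => /orP[|/eqP//].
rewrite lt_eqF//; apply: coef_lt0; rewrite ?inner_neq_origin//.
exact: adjacent_inner_origin.
Qed.
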